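(* Let $N\in\mathbb{N}$. The following growth and decay estimates hold as $i,j,k,l\to+\infty$. (a) If at least one of the eight combinations $\omega_i\pm\omega_j\pm\omega_k\pm\omega_l$ does not tend to $\infty$, then each of $\frac{\mathbb{R}_{klji}}{\omega_i}$, $\frac{\mathbb{S}_{jkli}}{\omega_i}$, $\overline{\mathbb{R}}_{klji}$, $\overline{\mathbb{S}}_{jkli}$ is $\mathcal{O}(\omega_j\omega_i^{-1})$, and each of $\omega_i\mathbb{H}_{klji}$, $\omega_i\overline{\mathbb{H}}_{ijkl}$ is $\mathcal{O}(\omega_i\omega_j\omega_k)$. (b) If all eight combinations $\omega_i\pm\omega_j\pm\omega_k\pm\omega_l\to\infty$, then each of $\frac{\mathbb{R}_{klji}}{\omega_i}$, $\frac{\mathbb{S}_{jkli}}{\omega_i}$, $\overline{\mathbb{R}}_{klji}$, $\overline{\mathbb{S}}_{jkli}$ is $$\frac{1}{\omega_i}\sum_\pm\mathcal{O}\left(\frac{1}{(\omega_i\pm\omega_j\pm\omega_k\pm\omega_l)^N}\right),$$ and each of $\omega_i\mathbb{H}_{klji}$, $\omega_i\overline{\mathbb{H}}_{ijkl}$ is $$\sum_\pm\mathcal{O}\left(\frac{\omega_i}{(\omega_i\pm\omega_j\pm\omega_k\pm\omega_l)^3}\right).$$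
   Context: For integers $i\ge 0$ and $x\in[0,\pi/2]$ set $\omega_i:=3+2i$ and $$e_i(x):=2\frac{\sqrt{i!\,(i+2)!}}{\Gamma(i+\frac32)}\cos^3(x)\,P_i^{(\frac12,\frac32)}(\cos(2x)),$$ where $P_i^{(\alpha,\beta)}$ are the Jacobi polynomials (Szegő's normalization); $e_i'$ is the derivative of $e_i$. Write $g_i(x):=\int_x^{\pi/2}e_i(y)\sin(y)\cos(y)\,dy$. The Fourier constants are $$\mathbb{R}_{klji}:=\int_0^{\pi/2}e_j\frac{e_k'}{\omega_k}\frac{e_l'}{\omega_l}\frac{e_i'}{\omega_i}\frac{\sin^3}{\cos}dx,\qquad \overline{\mathbb{R}}_{klji}:=\int_0^{\pi/2}e_j\frac{e_k'}{\omega_k}\frac{e_l'}{\omega_l}\,g_i\tan^2dx,$$ $$\mathbb{S}_{jkli}:=\int_0^{\pi/2}e_je_ke_l\frac{e_i'}{\omega_i}\frac{\sin^3}{\cos}dx,\qquad \overline{\mathbb{S}}_{jkli}:=\int_0^{\pi/2}e_je_ke_l\,g_i\tan^2dx,$$ $$\mathbb{H}_{klji}:=\int_0^{\pi/2}e_ie_je_ke_l\tan^2dx,\qquad \overline{\mathbb{H}}_{ijkl}:=\int_0^{\pi/2}e_je_k\frac{e_i'}{\omega_i}\frac{e_l'}{\omega_l}\tan^2dx.$$ Conventions. $\omega_i\pm\omega_j\pm\omega_k\pm\omega_l$ stands for all eight combinations of signs (with $\omega_i$ having sign $+$) and $\sum_\pm$ is the sum over all of them. The estimates are understood along arbitrary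 sequences of quadruples $(i,j,k,l)$ with all indices tending to $+\infty$; ''$\to\infty$'' for a combination means that it tends to $+\infty$ along the sequence. $\sum_\pm\mathcal{O}(f_\pm)$ denotes a quantity bounded in absolute value, for all sufficiently large indices along the sequence, by a constant (possibly depending on $N$) times $\sum_\pm|f_\pm|$. *)

(* Defs.v *)
From Stdlib Require Import Reals Factorial.
From Coquelicot Require Import Coquelicot.
Open Scope R_scope.

(** Euler's integral; it converges, and so is meaningful, only for [0 < z]. *)
Definition Gamma (z : R) : R :=
  RInt_gen (fun t => Rpower t (z - 1) * exp (- t))
           (at_right 0) (Rbar_locally p_infty).

(** Binomial coefficient [a (a - 1) ... (a - m + 1) / m!] with real [a]. *)
Fixpoint gbinom (a : R) (m : nat) : R :=
  match m with
  | O => 1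
  | S p => gbinom a p * (a - INR p) / INR (S p)
  end.

(** Szegő, Orthogonal Polynomials, (4.3.2); in this normalization
    [jacobi n a b 1 = gbinom (n + a) n]. *)
Definition jacobi (n : nat) (a b x : R) : R :=
  sum_f_R0 (fun s =>
    gbinom (INR n + a) (n - s) * gbinom (INR n + b) s
    * ((x - 1) / 2) ^ s * ((x + 1) / 2) ^ (n - s)) n.

Definition omega (i : nat) : R := 3 + 2 * INR i.

Definition e (i : nat) (x : R) : R :=
  2 * (sqrt (INR (fact i) * INR (fact (i + 2))) / Gamma (INR i + 3 / 2))
  * cos x ^ 3 * jacobi i (1 / 2) (3 / 2) (cos (2 * x)).

(** [e_i' / omega_i] *)
Definition de (i : nat) (x : R) : R := Derive (e i) x / omega i.

Definition g (i : nat) (x : R) : R :=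
  RInt (fun y => e i y * sin y * cos y) x (PI / 2).

(** The integrands below extend continuously to [PI / 2], where [tan] and
    [1 / cos] are singular; the junk value there does not affect [RInt]. *)
Definition Rc (k l j i : nat) : R :=
  RInt (fun x => e j x * de k x * de l x * de i x * (sin x ^ 3 / cos x))
       0 (PI / 2).

Definition Rbarc (k l j i : nat) : R :=
  RInt (fun x => e j x * de k x * de l x * g i x * tan x ^ 2) 0 (PI / 2).

Definition Sc (j k l i : nat) : R :=
  RInt (fun x => e j x * e k x * e l x * de i x * (sin x ^ 3 / cos x))
       0 (PI / 2).

Definition Sbarc (j k l i : nat) : R :=
  RInt (fun x => e j x * e k x * e l x * g i x * tan x ^ 2) 0 (PI / 2).

Definition Hc (k l j i : nat) : R :=
  RInt (fun x => e i x * e j x * e k x * e l x * tan x ^ 2) 0 (PI / 2).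

Definition Hbarc (i j k l : nat) : R :=
  RInt (fun x => e j x * e k x * de i x * de l x * tan x ^ 2) 0 (PI / 2).

(** A choice of the three signs in [omega_i ± omega_j ± omega_k ± omega_l]. *)
Definition signs : Type := (bool * bool * bool)%type.

Definition pm (b : bool) : R := if b then 1 else -1.

Definition comb (s : signs) (i j k l : nat) : R :=
  let '(a, b, c) := s in
  omega i + pm a * omega j + pm b * omega k + pm c * omega l.

Definition sum_pm (f : signs -> R) : R :=
  let sum2 (h : bool -> R) := h true + h false in
  sum2 (fun a => sum2 (fun b => sum2 (fun c => f (a, b, c)))).

Definition is_O (u f : nat -> R) : Prop :=
  exists C : R, eventually (fun n => Rabs (u n) <= C * Rabs (f n)).

(** [u] is a quantity of the form [sum_± O(f_±)]. *)
Definition is_sum_O (u : nat -> R) (f : signs -> nat -> R) : Prop :=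
  exists C : R,
    eventually (fun n => Rabs (u n) <= C * sum_pm (fun s => Rabs (f s n))).

(** [u] is a quantity of the form [p * sum_± O(f_±)]. *)
Definition is_mul_sum_O (u p : nat -> R) (f : signs -> nat -> R) : Prop :=
  exists v : nat -> R, is_sum_O v f /\ eventually (fun n => u n = p n * v n).

(* Main.v *)
Require Import Defs.
From Stdlib Require Import Reals Factorial Lra Lia.
From Coquelicot Require Import Coquelicot.
Open Scope R_scope.

(** Two facts give both halves.

    The first is that all six integrals vanish as soon as [omega i] exceeds
    [omega j + omega k + omega l] by a fixed amount ([integrals_vanish]), so
    that in case (b), where [omega i - omega j - omega k - omega l] tends to
    infinity, every quantity is eventually zero. Up to powers of [sin] and
    [cos], the functions [e_j] and [e_j'] are polynomials in [cos x ^ 2] of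
    degree about [j]. Hence each integrand is a kernel, namely
    [e_i sin^2 cos], [e_i' sin^3] or [g_i cos], times a polynomial in
    [cos x ^ 2] of degree at most [j + k + l + 6] (the lemmas [Rc_factors] to
    [Hbarc_factors]), and each kernel is orthogonal to all such polynomials of
    degree less than [i] ([e_annihilates], [de_annihilates],
    [g_annihilates]).

    The second is that the integrands themselves satisfy the growth bounds of
    case (a) pointwise, and the interval is bounded ([integrals_bounded]):
    [|e_j| <= A omega_j cos], while [|e_j|] and [|e_j' / omega_j|] are at most
    [A cos / sin], and [|g_i| <= A / omega_i] ([factor_bounds]).

    Both rest on the closed form, with [w = omega i],
<<
      e_i(x) sin x = amp_i (w cos x sin (w x) - sin x cos (w x)),
      e_i'(x) sin^2 x = amp_i w cos x (w sin x cos (w x) - cos x sin (w x)),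
>>
    where [amp_i = O(1 / w)]. It turns orthogonality into the
    vanishing of [int cos (w x) cos^p x] for odd [p < w], and the pointwise
    bounds into [|sin (w x)| <= w sin x] and [|cos (w x)| <= w cos x]. For the
    Jacobi sum the closed form is the binomial expansion of [sin (n x)] in
    disguise; for the size of [amp_i] the functional equation of Gamma is
    needed, its value at [3 / 2] entering only as an unspecified constant. *)

(** * The functional equation of the Gamma function *)

(** The improper form of the fundamental theorem that both the integration by
    parts and the convergence at [3 / 2] use: only the half line [0 < x] is
    constrained, as [Rpower] is meaningless elsewhere. *)
Lemma is_RInt_gen_antiderivative (f F : R -> R) (la lb : R) :
  (forall x, 0 < x -> is_derive F x (f x)) ->
  (forall x, 0 < x -> continuous f x) ->
  filterlim F (at_right 0) (locally la) ->
  filterlim F (Rbar_locally p_infty) (locally lb) ->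
  is_RInt_gen f (at_right 0) (Rbar_locally p_infty) (lb - la).
Proof.
  intros HF Hf Hla Hlb.
  assert (pos : forall P : R * R -> Prop,
    (forall a b, 0 < a -> 0 < b -> P (a, b)) ->
    filter_prod (at_right 0) (Rbar_locally p_infty) P).
  { intros P HP.
    apply (Filter_prod _ _ _ (fun a => 0 < a) (fun b => 0 < b)).
    - exists (mkposreal 1 Rlt_0_1). intros y _ Hy. exact Hy.
    - exists 0. intros y Hy. exact Hy.
    - exact HP. }
  assert (minpos : forall a b x, 0 < a -> 0 < b -> Rmin a b <= x -> 0 < x).
  { intros a b x Ha Hb Hx. apply Rlt_le_trans with (2 := Hx).
    now apply Rmin_glb_lt. }
  apply (is_RInt_gen_ext (Derive F)).
  - apply pos. intros a b Ha Hb x [Hx _]. simpl in Hx.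
    apply is_derive_unique, HF, (minpos a b); auto; lra.
  - apply is_RInt_gen_Derive; try assumption.
    + apply pos. intros a b Ha Hb x [Hx _]. simpl in Hx.
      exists (f x). apply HF, (minpos a b); auto.
    + apply pos. intros a b Ha Hb x [Hx _]. simpl in Hx.
      assert (Hx0 : 0 < x) by (apply (minpos a b); auto).
      apply (continuous_ext_loc _ f); [|now apply Hf].
      exists (mkposreal x Hx0). intros y Hy.
      symmetry. apply is_derive_unique, HF.
      apply Rabs_def2 in Hy. simpl in Hy. unfold minus, plus, opp in Hy.
      simpl in Hy. lra.
Qed.

Lemma exp_le (x y : R) : x <= y -> exp x <= exp y.
Proof.
  intros [H| ->]; [apply Rlt_le, exp_increasing, H|apply Rle_refl].
Qed.

Lemma filterlim_squeeze0 (F : (R -> Prop) -> Prop) {FF : Filter F}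
    (f h : R -> R) :
  F (fun x => 0 <= f x <= h x) ->
  filterlim h F (locally 0) -> filterlim f F (locally 0).
Proof.
  intros Hf Hh.
  apply (filterlim_le_le (FF := FF) (fun _ => 0) f h 0); auto.
  apply filterlim_const.
Qed.

Lemma exp_neg_half_lim (M : R) :
  filterlim (fun t => M * exp (- t / 2)) (Rbar_locally p_infty) (locally 0).
Proof.
  assert (H : is_lim (fun t => M * exp (- / 2 * t + 0)) p_infty (Rbar_mult M 0)).
  { apply is_lim_scal_l, is_lim_comp_lin; [|lra].
    replace (Rbar_plus _ _) with m_infty; [apply is_lim_exp_m|].
    simpl. destruct (Rle_dec 0 (- / 2)); [exfalso; lra|reflexivity]. }
  simpl in H. rewrite Rmult_0_r in H.
  apply (is_lim_ext _ (fun t => M * exp (- t / 2))) in H; [exact H|].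
  intros y. do 2 f_equal. field.
Qed.

(** From [ln u <= u - 1] at [u = t / (2 z)]: the power costs half of the
    exponential decay. *)
Lemma Rpower_exp_bound (z t : R) : 0 < z -> 0 < t ->
  Rpower t z * exp (- t) <= exp (z * ln (2 * z)) * exp (- t / 2).
Proof.
  intros Hz Ht. unfold Rpower. rewrite <- !exp_plus.
  apply exp_le.
  assert (H : ln (t / (2 * z)) <= t / (2 * z) - 1).
  { assert (H0 : 0 < t / (2 * z)) by (apply Rdiv_lt_0_compat; lra).
    pose proof (exp_ineq1_le (ln (t / (2 * z)))) as H1.
    rewrite exp_ln in H1; lra. }
  rewrite ln_div in H by lra.
  apply (Rmult_le_compat_l z) in H; [|lra].
  replace (z * (t / (2 * z) - 1)) with (t / 2 - z) in H by (field; lra).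
  lra.
Qed.

Lemma Rpower_exp_lim_infty (z : R) : 0 < z ->
  filterlim (fun t => Rpower t z * exp (- t))
    (Rbar_locally p_infty) (locally 0).
Proof.
  intros Hz.
  apply (filterlim_squeeze0 _ _ _)
    with (2 := exp_neg_half_lim (exp (z * ln (2 * z)))).
  exists 0. intros t Ht. split.
  - apply Rlt_le, Rmult_lt_0_compat; apply exp_pos.
  - now apply Rpower_exp_bound.
Qed.

Lemma Rpower_exp_lim_0 (z : R) : 1 <= z ->
  filterlim (fun t => Rpower t z * exp (- t)) (at_right 0) (locally 0).
Proof.
  intros Hz. apply (filterlim_squeeze0 _ _ (fun t => t)).
  - exists (mkposreal 1 Rlt_0_1). intros t Ht H0.
    apply Rabs_def2 in Ht. simpl in Ht. unfold minus, plus, opp in Ht.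
    simpl in Ht. split.
    { apply Rlt_le, Rmult_lt_0_compat; apply exp_pos. }
    rewrite <- (Rmult_1_r t) at 3. apply Rmult_le_compat.
    + apply Rlt_le, exp_pos.
    + apply Rlt_le, exp_pos.
    + rewrite <- (exp_ln t) at 2 by exact H0. apply exp_le.
      assert (ln t <= 0) by (rewrite <- ln_1; apply ln_le; lra). nra.
    + rewrite <- exp_0. apply exp_le. lra.
  - apply (filterlim_filter_le_1 _ (filter_le_within (F := locally 0) _)).
    apply filterlim_id.
Qed.

Lemma is_derive_Rpower_exp (z t : R) : 0 < t ->
  is_derive (fun t => Rpower t z * exp (- t)) t
    (z * (Rpower t (z - 1) * exp (- t)) - Rpower t z * exp (- t)).
Proof.
  intros Ht. unfold Rpower. auto_derive; [exact Ht|].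
  replace ((z - 1) * ln t) with (z * ln t + - ln t) by ring.
  rewrite (exp_plus (z * ln t)), (exp_Ropp (ln t)), exp_ln by exact Ht. field. lra.
Qed.

(** The value of [RInt_gen] says nothing about convergence, so the functional
    equation is carried by statements that include it. *)
Definition Gamma_integral (z v : R) : Prop :=
  is_RInt_gen (fun t => Rpower t (z - 1) * exp (- t))
    (at_right 0) (Rbar_locally p_infty) v.

Lemma Gamma_integral_unique (z v : R) : Gamma_integral z v -> Gamma z = v.
Proof.
  intros H. exact (is_RInt_gen_unique (V := R_CompleteNormedModule) _ _ H).
Qed.

(** Integration by parts: the derivative of [t^z exp (- t)] has integral zero
    over the half line. *)
Lemma Gamma_integral_succ (z v : R) : 1 <= z ->
  Gamma_integral z v -> Gamma_integral (z + 1) (z * v).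
Proof.
  intros Hz Hv.
  assert (Hparts : is_RInt_gen
    (fun t => z * (Rpower t (z - 1) * exp (- t)) - Rpower t z * exp (- t))
    (at_right 0) (Rbar_locally p_infty) (0 - 0)).
  { apply is_RInt_gen_antiderivative
      with (F := fun t => Rpower t z * exp (- t)).
    - intros t. apply is_derive_Rpower_exp.
    - intros t Ht. apply (ex_derive_continuous
        (fun t => z * (Rpower t (z - 1) * exp (- t)) - Rpower t z * exp (- t))).
      unfold Rpower. auto_derive. auto.
    - now apply Rpower_exp_lim_0.
    - apply Rpower_exp_lim_infty. lra. }
  unfold Gamma_integral.
  replace (z * v) with (minus (scal z v) (0 - 0))
    by (unfold minus, plus, opp, scal; simpl; unfold mult; simpl; ring).
  eapply is_RInt_gen_ext;
    [|exact (is_RInt_gen_minus _ _ _ _ (is_RInt_gen_scal _ z _ Hv) Hparts)].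
  apply filter_forall. intros ab x _.
  replace (z + 1 - 1) with z by ring.
  unfold minus, plus, opp, scal; simpl; unfold mult; simpl. ring.
Qed.

Lemma nondecreasing_bounded_lim (F : R -> R) (M : R) :
  (forall x y, 0 <= x <= y -> F x <= F y) -> (forall x, 0 <= x -> F x <= M) ->
  exists l : R, filterlim F (Rbar_locally p_infty) (locally l).
Proof.
  intros Hmono HM.
  destruct (completeness (fun y => exists x, 0 <= x /\ y = F x)) as [l [Hub Hl]].
  - exists M. intros y [x [Hx ->]]. now apply HM.
  - exists (F 0), 0. lra.
  - exists l. apply filterlim_locally. intros [eps Heps].
    assert (Hex : exists x, 0 <= x /\ l - eps < F x).
    { apply Classical_Prop.NNPP. intros Hn.
      assert (l <= l - eps); [|lra].
      apply Hl. intros y [x [Hx ->]].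
      apply Rnot_lt_le. intros Hlt. apply Hn. now exists x. }
    destruct Hex as [x [Hx Hlx]].
    exists x. intros y Hy.
    apply Rabs_def1; unfold minus, plus, opp; simpl.
    + assert (F y <= l) by (apply Hub; exists y; split; [lra|reflexivity]). lra.
    + assert (F x <= F y) by (apply Hmono; lra). lra.
Qed.

(** The primitive of [sqrt t exp (- t)] increases, and it is bounded because
    [sqrt t <= exp (t / 2)]. *)
Lemma Gamma_3_2_integral : exists v, Gamma_integral (3 / 2) v.
Proof.
  set (f := fun t => sqrt t * exp (- t)).
  assert (Hcont : forall t, continuous f t).
  { intros t. apply (continuous_mult sqrt (fun t => exp (- t))).
    - apply continuous_sqrt.
    - apply (ex_derive_continuous (fun t => exp (- t))). auto_derive. auto. }
  assert (Hex : forall a b, ex_RInt f a b)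
    by (intros; apply (ex_RInt_continuous f); intros; apply Hcont).
  set (F := (fun x => RInt f 0 x) : R -> R).
  assert (HF : forall x, is_derive F x (f x)).
  { intros x. apply (is_derive_RInt f F 0 x).
    - apply filter_forall. intros y.
      apply (RInt_correct (V := R_CompleteNormedModule)), Hex.
    - apply Hcont. }
  assert (Hpos : forall t, 0 <= f t)
    by (intros t; apply Rmult_le_pos; [apply sqrt_pos|apply Rlt_le, exp_pos]).
  assert (Hle : forall t, 0 <= t -> f t <= exp (- t / 2)).
  { intros t Ht. unfold f.
    replace (- t) with (- t / 2 + - t / 2) at 1 by field. rewrite exp_plus.
    assert (H : sqrt t * exp (- t / 2) <= 1).
    { apply (Rmult_le_reg_r (exp (t / 2))); [apply exp_pos|].
      rewrite Rmult_assoc, <- exp_plus.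
      replace (- t / 2 + t / 2) with 0 by field. rewrite exp_0.
      pose proof (exp_ineq1_le (t / 2)). pose proof (sqrt_sqrt t Ht).
      nra. }
    pose proof (exp_pos (- t / 2)). nra. }
  destruct (nondecreasing_bounded_lim F 2) as [l Hl].
  - intros x y Hxy. unfold F. rewrite <- (RInt_Chasles f 0 x y) by apply Hex.
    assert (0 <= RInt f x y) by (apply RInt_ge_0; auto; lra).
    unfold plus; simpl. lra.
  - intros x Hx.
    assert (Hint : is_RInt (fun t => exp (- t / 2)) 0 x
        (minus (- 2 * exp (- x / 2)) (- 2 * exp (- 0 / 2)))).
    { apply (is_RInt_derive (fun t => - 2 * exp (- t / 2))
        (fun t => exp (- t / 2))).
      - intros t _. auto_derive; [auto|]. unfold Rdiv. field.
      - intros t _. apply (ex_derive_continuous (fun t => exp (- t / 2))).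
        auto_derive. auto. }
    apply Rle_trans with (RInt (fun t => exp (- t / 2)) 0 x).
    + apply RInt_le; auto; [now eexists; exact Hint|]. intros t Ht. apply Hle. lra.
    + rewrite (is_RInt_unique _ _ _ _ Hint).
      unfold minus, plus, opp; simpl.
      replace (- 0 / 2) with 0 by field. rewrite exp_0.
      pose proof (exp_pos (- x / 2)). lra.
  - exists (l - 0). unfold Gamma_integral.
    apply (is_RInt_gen_ext f).
    + apply (Filter_prod _ _ _ (fun a => 0 < a) (fun b => 0 < b)).
      * exists (mkposreal 1 Rlt_0_1). intros y _ Hy. exact Hy.
      * exists 0. intros y Hy. exact Hy.
      * intros a b Ha Hb x [Hx _]. simpl in Hx. unfold f.
        assert (0 < x) by (pose proof (Rmin_glb_lt _ _ _ Ha Hb); lra).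
        rewrite <- Rpower_sqrt by assumption. do 2 f_equal. field.
    + apply (is_RInt_gen_antiderivative f F); auto.
      replace 0 with (F 0) at 2
        by exact (RInt_point (V := R_CompleteNormedModule) 0 f).
      apply (filterlim_filter_le_1 _ (filter_le_within (F := locally 0) _)).
      apply (ex_derive_continuous F). eexists. apply HF.
Qed.

(** Absorption, [(m + 1) binom (a + 1, m + 1) = (a + 1) binom (a, m)]. *)
Lemma gbinom_succ_succ (a : R) (m : nat) :
  gbinom (a + 1) (S m) = gbinom a m * (a + 1) / INR (S m).
Proof.
  induction m as [|m IH].
  - simpl. field.
  - change (gbinom (a + 1) (S (S m)))
      with (gbinom (a + 1) (S m) * (a + 1 - INR (S m)) / INR (S (S m))).
    rewrite IH. change (gbinom a (S m)) with (gbinom a m * (a - INR m) / INR (S m)).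
    rewrite !S_INR. pose proof (pos_INR m). field. lra.
Qed.

(** The product [(3/2) (5/2) ... (i + 1/2)] is here [gbinom (i + 1/2) i * i!],
    the form in which it cancels against the value at [1] of the Jacobi
    polynomial. *)
Lemma Gamma_half_integer (i : nat) :
  Gamma (INR i + 3 / 2) =
  Gamma (3 / 2) * (gbinom (INR i + 1 / 2) i * INR (fact i)).
Proof.
  destruct Gamma_3_2_integral as [v Hv].
  rewrite (Gamma_integral_unique _ _ Hv).
  apply Gamma_integral_unique. induction i as [|i IH].
  - simpl. replace (0 + 3 / 2) with (3 / 2) by ring.
    now replace (v * (1 * 1)) with v by ring.
  - apply Gamma_integral_succ in IH; [|pose proof (pos_INR i); lra].
    replace (INR (S i) + 3 / 2) with (INR i + 3 / 2 + 1) by (rewrite S_INR; ring).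
    replace (v * _) with
      ((INR i + 3 / 2) * (v * (gbinom (INR i + 1 / 2) i * INR (fact i)))); [exact IH|].
    replace (INR (S i) + 1 / 2) with (INR i + 1 / 2 + 1) by (rewrite S_INR; ring).
    rewrite gbinom_succ_succ, fact_simpl, mult_INR, S_INR.
    pose proof (pos_INR i). field. lra.
Qed.

(** * Binomial expansion of the closed form *)

Lemma binomial_succ_r (n k : nat) : (k < n)%nat ->
  Binomial.C n (S k) * (INR k + 1) = Binomial.C n k * (INR n - INR k).
Proof.
  intros H. unfold Binomial.C.
  replace (n - k)%nat with (S (n - S k)) by lia.
  rewrite !fact_simpl, !mult_INR, !S_INR, minus_INR, S_INR by lia.
  assert (INR k + 1 <= INR n) by (rewrite <- S_INR; apply le_INR; lia).
  pose proof (pos_INR k). field.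
  repeat split; try apply INR_fact_neq_0; lra.
Qed.

Lemma binomial_succ_l (n k : nat) : (k <= n)%nat ->
  (INR n + 1) * Binomial.C n k = (INR n + 1 - INR k) * Binomial.C (S n) k.
Proof.
  intros H. unfold Binomial.C.
  replace (S n - k)%nat with (S (n - k)) by lia.
  rewrite !fact_simpl, !mult_INR, !S_INR, minus_INR by lia.
  assert (INR k <= INR n) by (apply le_INR; lia).
  field. repeat split; try apply INR_fact_neq_0; lra.
Qed.

Lemma binomial_0 (n : nat) : Binomial.C n 0 = 1.
Proof.
  unfold Binomial.C. rewrite Nat.sub_0_r. simpl. field. apply INR_fact_neq_0.
Qed.

Lemma binomial_n (n : nat) : Binomial.C n n = 1.
Proof.
  unfold Binomial.C. rewrite Nat.sub_diag. simpl. field. apply INR_fact_neq_0.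
Qed.

(** The binomial theorem for [(c + s T)^n], with [T] the shift of the second
    index. With [T] the translation by a quarter period it is de Moivre's
    formula without complex numbers. *)
Lemma binomial_shift (c s : R) (G : nat -> nat -> R) :
  (forall n j, G (S n) j = c * G n j + s * G n (S j)) ->
  forall n j, G n j =
    sum_f_R0 (fun k =>
      Binomial.C n k * c ^ (n - k) * s ^ k * G 0%nat (j + k)%nat) n.
Proof.
  intros HG n. induction n as [|n IH]; intros j.
  - unfold sum_f_R0. rewrite binomial_0, Nat.add_0_r. simpl. ring.
  - rewrite HG, !IH. destruct n as [|m].
    { unfold sum_f_R0. rewrite !binomial_0, binomial_n.
      replace (j + 1)%nat with (S j + 0)%nat by lia.
      rewrite !Nat.add_0_r. simpl. ring. }
    rewrite (decomp_sum (fun k => Binomial.C (S (S m)) k * _ * _ * _) (S (S m))) by lia.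
    rewrite (decomp_sum (fun k => _ * G 0%nat (j + k)%nat) (S m)) by lia.
    simpl pred. rewrite !tech5.
    replace (sum_f_R0 (fun k => Binomial.C (S (S m)) (S k) * _ * _ * _) m)
      with (c * sum_f_R0 (fun k => Binomial.C (S m) (S k) * c ^ (S m - S k)
                * s ^ S k * G 0%nat (j + S k)%nat) m
            + s * sum_f_R0 (fun k => Binomial.C (S m) k * c ^ (S m - k)
                * s ^ k * G 0%nat (S j + k)%nat) m).
    + rewrite !binomial_n, !binomial_0, !Nat.sub_diag, !Nat.sub_0_r.
      replace (S j + S m)%nat with (j + S (S m))%nat by lia.
      rewrite !Nat.add_0_r. simpl. ring.
    + rewrite !scal_sum, <- sum_plus. apply sum_eq. intros k Hk.
      rewrite <- (pascal (S m) k) by lia.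
      replace (S j + k)%nat with (j + S k)%nat by lia.
      replace (S (S m) - S k)%nat with (S (m - k)) by lia.
      replace (S m - S k)%nat with (m - k)%nat by lia.
      replace (S m - k)%nat with (S (m - k)) by lia. simpl. ring.
Qed.

Lemma sin_mult_binomial (n : nat) (x : R) :
  sin (INR n * x) =
  sum_f_R0 (fun k => Binomial.C n k * cos x ^ (n - k) * sin x ^ k
                     * sin (INR k * (PI / 2))) n.
Proof.
  pose proof (binomial_shift (cos x) (sin x)
    (fun n j => sin (INR n * x + INR j * (PI / 2)))) as H.
  rewrite <- (Rplus_0_r (INR n * x)).
  replace 0 with (INR 0 * (PI / 2)) at 1 by (simpl; ring).
  rewrite H.
  - apply sum_eq. intros k _. do 2 f_equal. simpl. ring.
  - intros m j. rewrite !S_INR.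
    replace ((INR m + 1) * x + INR j * (PI / 2))
      with (x + (INR m * x + INR j * (PI / 2))) by ring.
    replace (INR m * x + (INR j + 1) * (PI / 2))
      with (PI / 2 + (INR m * x + INR j * (PI / 2))) by ring.
    rewrite sin_plus, <- cos_sin. ring.
Qed.

(** In [(c + i s)^n] the operator [c d/dc - 1] multiplies the monomial
    [c^(n - k) s^k] by [n - k - 1]; applied to the imaginary part [sin (n x)]
    it gives the left-hand side. *)
Lemma sin_mult_binomial_weighted (m : nat) (x : R) :
  INR (S m) * cos x * sin (INR m * x) - sin (INR (S m) * x) =
  sum_f_R0 (fun k => (INR (S m) - INR k - 1) * Binomial.C (S m) k
     * cos x ^ (S m - k) * sin x ^ k * sin (INR k * (PI / 2))) (S m).
Proof.
  rewrite !sin_mult_binomial, !tech5, scal_sum.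
  rewrite (sum_eq _ (fun k => (INR (S m) - INR k - 1) * Binomial.C (S m) k
       * cos x ^ (S m - k) * sin x ^ k * sin (INR k * (PI / 2))
     + Binomial.C (S m) k * cos x ^ (S m - k) * sin x ^ k
       * sin (INR k * (PI / 2)))).
  - rewrite sum_plus. ring.
  - intros k Hk. pose proof (binomial_succ_l m k Hk) as HC. rewrite S_INR.
    replace (S m - k)%nat with (S (m - k)) by lia. simpl pow.
    transitivity ((INR m + 1) * Binomial.C m k *
      (cos x * cos x ^ (m - k) * sin x ^ k * sin (INR k * (PI / 2)))); [ring|].
    rewrite HC. ring.
Qed.

Lemma sin_even_quarter (s : nat) : sin (INR (2 * s) * (PI / 2)) = 0.
Proof.
  rewrite mult_INR. replace (INR 2 * INR s * (PI / 2)) with (INR s * PI)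
    by (simpl; field).
  rewrite INR_IZR_INZ. apply sin_eq_0_1. now eexists.
Qed.

Lemma sin_odd_quarter (s : nat) : sin (INR (S (2 * s)) * (PI / 2)) = (-1) ^ s.
Proof.
  induction s as [|s IH].
  - simpl. rewrite Rmult_1_l. apply sin_PI2.
  - replace (INR (S (2 * S s)) * (PI / 2)) with (INR (S (2 * s)) * (PI / 2) + PI).
    + rewrite neg_sin, IH. simpl. ring.
    + rewrite !S_INR, !mult_INR, !S_INR. simpl. field.
Qed.

(** [kappa i x / cos x] is the odd solution of the Poeschl-Teller
    equation [u'' = (2 / cos^2 x - omega^2) u], which [u = tan x * e_i(x)]
    satisfies. *)
Definition kappa (i : nat) (x : R) : R :=
  omega i * cos x * sin (omega i * x) - sin x * cos (omega i * x).

(** Only odd powers of the sine survive in the expansion, and the last one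
    drops out because, at [k = n - 1] with [n = 2i + 4], its weight
    [n - k - 1] is zero. *)
Lemma kappa_binomial (i : nat) (x : R) :
  kappa i x =
  sum_f_R0 (fun s => (2 * INR (i - s) + 2) * Binomial.C (2 * i + 4) (2 * s + 1)
      * (-1) ^ s * cos x ^ (2 * (i - s) + 3) * sin x ^ (2 * s + 1)) i.
Proof.
  assert (Hw : omega i = INR (2 * i + 3)).
  { unfold omega. rewrite plus_INR, mult_INR. simpl. ring. }
  assert (Hk : kappa i x = INR (2 * i + 4) * cos x * sin (INR (2 * i + 3) * x)
                           - sin (INR (2 * i + 4) * x)).
  { unfold kappa. rewrite Hw. replace (2 * i + 4)%nat with (S (2 * i + 3)) by lia.
    rewrite S_INR, (Rmult_plus_distr_r (INR (2 * i + 3)) 1 x), Rmult_1_l, sin_plus.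
    ring. }
  rewrite Hk. clear Hk.
  replace (2 * i + 4)%nat with (S (2 * i + 3)) by lia.
  rewrite sin_mult_binomial_weighted.
  replace (S (2 * i + 3)) with (2 * i + 4)%nat by lia.
  set (F := fun k => (INR (2 * i + 4) - INR k - 1) * Binomial.C (2 * i + 4) k
     * cos x ^ (2 * i + 4 - k) * sin x ^ k * sin (INR k * (PI / 2))).
  { replace (2 * i + 4)%nat with (2 * S (S i))%nat by lia.
    rewrite <- sum_decomposition.
    rewrite (sum_eq (fun l => F (2 * l)%nat) (fun _ => 0)).
    2:{ intros k _. unfold F. rewrite sin_even_quarter. ring. }
    rewrite sum_cte, tech5.
    replace (F (S (2 * S i))) with 0.
    2:{ unfold F. replace (S (2 * S i)) with (2 * i + 3)%nat by lia.
        rewrite !plus_INR, !mult_INR. simpl INR. ring. }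
    rewrite Rmult_0_l, Rplus_0_l, Rplus_0_r. apply sum_eq. intros s Hs.
    unfold F. rewrite sin_odd_quarter.
    replace (2 * S (S i))%nat with (2 * i + 4)%nat by lia.
    replace (2 * i + 4 - S (2 * s))%nat with (2 * (i - s) + 3)%nat by lia.
    rewrite minus_INR, S_INR, mult_INR, plus_INR, mult_INR by lia.
    replace (S (2 * s)) with (2 * s + 1)%nat by lia.
    simpl INR. ring. }
Qed.

(** Half-integral binomial coefficients are ordinary ones with doubled
    arguments: as functions of [s], both sides have the same ratio of
    consecutive terms, [(2i + 3 - 2s)(2i - 2s) / ((2s + 2)(2s + 3))]. *)
Lemma gbinom_prod_binomial (i s : nat) : (s <= i)%nat ->
  gbinom (INR i + 1 / 2) (i - s) * gbinom (INR i + 3 / 2) s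
    * ((2 * INR i + 2) * (2 * INR i + 4)) =
  gbinom (INR i + 1 / 2) i *
    ((2 * INR (i - s) + 2) * Binomial.C (2 * i + 4) (2 * s + 1)).
Proof.
  induction s as [|s IH]; intros Hs.
  - rewrite Nat.sub_0_r. simpl gbinom. simpl (2 * 0 + 1)%nat.
    pose proof (binomial_succ_r (2 * i + 4) 0 ltac:(lia)) as H.
    rewrite binomial_0, plus_INR, mult_INR in H. simpl INR in H.
    replace (Binomial.C (2 * i + 4) 1) with (2 * INR i + 4) by lra. ring.
  - specialize (IH ltac:(lia)).
    pose proof (binomial_succ_r (2 * i + 4) (2 * s + 1) ltac:(lia)) as H1.
    pose proof (binomial_succ_r (2 * i + 4) (S (2 * s + 1)) ltac:(lia)) as H2.
    replace (S (S (2 * s + 1))) with (2 * S s + 1)%nat in H2 by lia.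
    replace (i - s)%nat with (S (i - S s)) in IH by lia.
    cbn [gbinom] in *. rewrite !S_INR in *. rewrite minus_INR in * by lia.
    rewrite ?S_INR, ?plus_INR, ?mult_INR, ?S_INR in *. simpl INR in *.
    assert (HI : INR s + 1 <= INR i) by (rewrite <- S_INR; apply le_INR; lia).
    pose proof (pos_INR s) as Hs0.
    set (a := INR s) in *. set (b := INR i) in *.
    set (C1 := Binomial.C (2 * i + 4) (2 * s + 1)) in *.
    set (C2 := Binomial.C (2 * i + 4) (S (2 * s + 1))) in *.
    set (C3 := Binomial.C (2 * i + 4) (2 * S s + 1)) in *.
    set (g1 := gbinom (b + 1 / 2) (i - S s)) in *.
    set (g2 := gbinom (b + 3 / 2) s) in *.
    set (g0 := gbinom (b + 1 / 2) i) in *.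
    (* two steps along the row of binomial coefficients, from [2s+1] to [2s+3] *)
    assert (HC : C3 * ((2 * a + 3) * (2 * a + 2)) =
                 C1 * ((2 * b + 3 - 2 * a) * (2 * b + 2 - 2 * a))).
    { transitivity (C2 * (2 * b + 2 - 2 * a) * (2 * a + 2)).
      - replace (C2 * (2 * b + 2 - 2 * a)) with (C3 * (2 * a + 3)); [ring|]. lra.
      - replace (C2 * (2 * b + 2 - 2 * a) * (2 * a + 2))
          with ((C2 * (2 * a + 2)) * (2 * b + 2 - 2 * a)) by ring.
        replace (C2 * (2 * a + 2)) with (C1 * (2 * b + 3 - 2 * a)) by lra. ring. }
    replace (b + 1 / 2 - (b - (a + 1))) with (a + 3 / 2) in IH by field.
    replace (b - (a + 1) + 1) with (b - a) in IH by ring.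
    assert (IH' : g1 * (a + 3 / 2) * g2 * ((2 * b + 2) * (2 * b + 4)) =
       g0 * ((2 * (b - a) + 2) * C1) * (b - a)).
    { rewrite <- IH. field. lra. }
    (* clears the denominator of the ratio of consecutive terms *)
    apply (Rmult_eq_reg_r ((2 * a + 3) * (2 * a + 2) * (a + 1))); [|nra].
    transitivity (2 * (b + 3 / 2 - a) * (2 * a + 2)
      * (g1 * (a + 3 / 2) * g2 * ((2 * b + 2) * (2 * b + 4)))).
    { field. lra. }
    rewrite IH'.
    transitivity (g0 * (2 * (b - a)) * (a + 1)
      * (C3 * ((2 * a + 3) * (2 * a + 2)))); [|ring].
    rewrite HC. field.
Qed.

(** * Closed form and amplitude of the modes *)

(** With [(cos 2x - 1) / 2 = - sin^2] and [(cos 2x + 1) / 2 = cos^2], the Jacobi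
    sum and [kappa_binomial] agree term by term. *)
Lemma jacobi_closed_form (i : nat) (x : R) :
  cos x ^ 3 * jacobi i (1 / 2) (3 / 2) (cos (2 * x)) * sin x =
  gbinom (INR i + 1 / 2) i / ((2 * INR i + 2) * (2 * INR i + 4)) * kappa i x.
Proof.
  rewrite kappa_binomial. unfold jacobi.
  rewrite !scal_sum, Rmult_comm, scal_sum. apply sum_eq. intros s Hs.
  pose proof (gbinom_prod_binomial i s Hs) as Hc.
  pose proof (pos_INR i).
  rewrite pow_add, (pow_mult (cos x)).
  rewrite (pow_add (sin x)), (pow_mult (sin x)), pow_1.
  replace ((cos (2 * x) - 1) / 2) with (-1 * sin x ^ 2)
    by (rewrite cos_2a_sin; field).
  replace ((cos (2 * x) + 1) / 2) with (cos x ^ 2)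
    by (rewrite cos_2a_cos; field).
  rewrite Rpow_mult_distr.
  apply (Rmult_eq_reg_r ((2 * INR i + 2) * (2 * INR i + 4))); [|nra].
  transitivity (gbinom (INR i + 1 / 2) (i - s) * gbinom (INR i + 3 / 2) s *
    ((2 * INR i + 2) * (2 * INR i + 4)) * ((-1) ^ s * (sin x ^ 2) ^ s
      * (cos x ^ 2) ^ (i - s) * cos x ^ 3 * sin x)); [ring|].
  rewrite Hc. field. lra.
Qed.

Definition amp (i : nat) : R :=
  2 * (sqrt (INR (fact i) * INR (fact (i + 2))) / Gamma (INR i + 3 / 2)) *
  (gbinom (INR i + 1 / 2) i / ((2 * INR i + 2) * (2 * INR i + 4))).

Lemma e_closed_form (i : nat) (x : R) : e i x * sin x = amp i * kappa i x.
Proof.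
  unfold amp. rewrite Rmult_assoc, <- jacobi_closed_form. unfold e. ring.
Qed.

Lemma gbinom_half_pos (i : nat) : 0 < gbinom (INR i + 1 / 2) i.
Proof.
  induction i as [|i IH]; [simpl; lra|].
  replace (INR (S i) + 1 / 2) with (INR i + 1 / 2 + 1) by (rewrite S_INR; ring).
  rewrite gbinom_succ_succ. pose proof (pos_INR i).
  apply Rdiv_lt_0_compat; [|apply lt_0_INR; lia].
  apply Rmult_lt_0_compat; lra.
Qed.

Lemma omega_ge_3 (i : nat) : 3 <= omega i.
Proof. unfold omega. pose proof (pos_INR i). lra. Qed.

(** The factorials and [gbinom] cancel, leaving
    [amp i = sqrt ((i + 1) (i + 2)) / (2 Gamma (3/2) (i + 1) (i + 2))];
    the estimate [i! (i + 2)! <= (i! (i + 2))^2] is accurate enough. *)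
Lemma amp_bound : exists A, 0 < A /\ forall i, Rabs (amp i) * omega i <= A.
Proof.
  exists (2 * Rabs (/ Gamma (3 / 2)) + 1).
  pose proof (Rabs_pos (/ Gamma (3 / 2))) as HG. split; [lra|]. intros i.
  unfold amp, omega. rewrite Gamma_half_integer.
  pose proof (gbinom_half_pos i) as Hg. pose proof (pos_INR i) as Hi.
  pose proof (INR_fact_lt_0 i) as Hf.
  set (h := gbinom (INR i + 1 / 2) i) in *. set (n := INR i) in *.
  assert (Hs : 0 <= sqrt (INR (fact i) * INR (fact (i + 2))) <= INR (fact i) * (n + 2)).
  { split; [apply sqrt_pos|].
    rewrite <- (sqrt_Rsqr (INR (fact i) * (n + 2))) by nra.
    apply sqrt_le_1_alt. unfold Rsqr.
    replace (i + 2)%nat with (S (S i)) by lia.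
    rewrite !fact_simpl, !mult_INR, !S_INR. fold n.
    assert (0 <= INR (fact i) * INR (fact i) * (n + 2))
      by (repeat apply Rmult_le_pos; lra).
    lra. }
  set (r := sqrt _) in *. set (G0 := Gamma (3 / 2)) in *.
  unfold Rdiv. rewrite (Rinv_mult G0). set (G := / G0) in *.
  replace (2 * (r * (G * / (h * INR (fact i)))) *
     (h * / ((2 * n + 2) * (2 * n + 4))))
    with (G * (r / INR (fact i) * / (2 * (n + 1) * (n + 2))))
    by (field; repeat split; lra).
  assert (Hr : 0 <= r / INR (fact i) <= n + 2).
  { split.
    - apply Rle_div_r; lra.
    - apply Rle_div_l; [lra|]. rewrite Rmult_comm. apply Hs. }
  assert (Hd : 0 < / (2 * (n + 1) * (n + 2))) by (apply Rinv_0_lt_compat; nra).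
  rewrite Rabs_mult, (Rabs_pos_eq (_ * / _)) by (apply Rmult_le_pos; lra).
  rewrite Rmult_assoc.
  assert (Hle : r / INR (fact i) * / (2 * (n + 1) * (n + 2)) * (3 + 2 * n) <= 2).
  { apply Rle_trans with ((n + 2) * / (2 * (n + 1) * (n + 2)) * (3 + 2 * n)).
    - apply Rmult_le_compat_r; [lra|]. apply Rmult_le_compat_r; lra.
    - replace ((n + 2) * / (2 * (n + 1) * (n + 2)) * (3 + 2 * n))
        with ((3 + 2 * n) / (2 * (n + 1))) by (field; lra).
      apply Rle_div_l; lra. }
  apply Rle_trans with (Rabs G * 2); [|lra].
  now apply Rmult_le_compat_l.
Qed.

(** * Even trigonometric polynomials *)

(** The span of [cos^(2m)], [m <= n], that is, the even trigonometric
    polynomials of period [PI] and degree at most [2n]. Generating the span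
    inductively makes every linear statement about it reduce to powers. *)
Inductive even_trig (n : nat) : (R -> R) -> Prop :=
| even_trig_pow m : (m <= n)%nat -> even_trig n (fun x => cos x ^ (2 * m))
| even_trig_lin a p q : even_trig n p -> even_trig n q ->
    even_trig n (fun x => a * p x + q x)
| even_trig_ext p q : (forall x, p x = q x) -> even_trig n p -> even_trig n q.

Lemma even_trig_scal n a p : even_trig n p -> even_trig n (fun x => a * p x).
Proof.
  intros Hp. apply even_trig_ext
    with (fun x => a * p x + (-1 * p x + p x)); [intros; ring|].
  now repeat apply even_trig_lin.
Qed.

Lemma even_trig_plus n p q :
  even_trig n p -> even_trig n q -> even_trig n (fun x => p x + q x).
Proof.
  intros Hp Hq. apply even_trig_ext with (fun x => 1 * p x + q x); [intros; ring|].
  now apply even_trig_lin.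
Qed.

Lemma even_trig_mono n m p : (n <= m)%nat -> even_trig n p -> even_trig m p.
Proof.
  intros H Hp. induction Hp as [r Hr|a p q _ IHp _ IHq|p q Heq _ IHp].
  - apply even_trig_pow. lia.
  - now apply even_trig_lin.
  - now apply even_trig_ext with p.
Qed.

Lemma even_trig_mult n m p q : even_trig n p -> even_trig m q ->
  even_trig (n + m) (fun x => p x * q x).
Proof.
  intros Hp Hq. induction Hp as [r Hr|a p p' _ IHp _ IHp'|p p' Heq _ IHp].
  - induction Hq as [s Hs|a q q' _ IHq _ IHq'|q q' Heq _ IHq].
    + apply even_trig_ext with (fun x => cos x ^ (2 * (r + s))).
      * intros x. rewrite <- pow_add. f_equal. lia.
      * apply even_trig_pow. lia.
    + eapply even_trig_ext; [|exact (even_trig_lin _ a _ _ IHq IHq')].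
      intros x. simpl. ring.
    + eapply even_trig_ext; [|exact IHq]. intros x. simpl. now rewrite Heq.
  - eapply even_trig_ext; [|exact (even_trig_lin _ a _ _ IHp IHp')].
    intros x. simpl. ring.
  - eapply even_trig_ext; [|exact IHp]. intros x. simpl. now rewrite Heq.
Qed.

Lemma even_trig_1 n : even_trig n (fun _ => 1).
Proof. apply (even_trig_pow n 0). lia. Qed.

Lemma even_trig_cos2 : even_trig 1 (fun x => cos x ^ 2).
Proof. apply (even_trig_pow 1 1). lia. Qed.

Lemma even_trig_sin2 : even_trig 1 (fun x => sin x ^ 2).
Proof.
  apply even_trig_ext with (fun x => -1 * cos x ^ 2 + 1).
  - intros x. pose proof (sin2_cos2 x). unfold Rsqr in *. simpl. lra.
  - apply even_trig_lin; [apply even_trig_cos2|apply even_trig_1].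
Qed.

Lemma even_trig_power n p m : even_trig n p -> even_trig (m * n) (fun x => p x ^ m).
Proof.
  intros Hp. induction m as [|m IH]; [apply even_trig_1|].
  now apply (even_trig_mult n (m * n)).
Qed.

Lemma even_trig_sum n m (p : nat -> R -> R) :
  (forall s, (s <= m)%nat -> even_trig n (p s)) ->
  even_trig n (fun x => sum_f_R0 (fun s => p s x) m).
Proof.
  intros Hp. induction m as [|m IH]; [now apply Hp|].
  simpl. apply even_trig_plus; [|now apply Hp].
  apply IH. intros s Hs. apply Hp. lia.
Qed.

(** The factor [cos * sin] is kept apart: the derivative of an even polynomial
    is odd, and it is the quotient that stays in the span. *)
Lemma even_trig_derive n q : even_trig n q ->
  exists r, even_trig n r /\ forall x, is_derive q x (cos x * sin x * r x).
Proof.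
  intros Hq. induction Hq as [m Hm|a p q _ IHp _ IHq|p q Heq _ IHp].
  - destruct m as [|m].
    + exists (fun _ => 0 * 1). split; [apply even_trig_scal, even_trig_1|].
      intros x. simpl. auto_derive; [auto|ring].
    + exists (fun x => - (2 * INR (S m)) * cos x ^ (2 * m)). split.
      * apply even_trig_scal, even_trig_pow. lia.
      * intros x. remember (2 * S m)%nat as k eqn:Hk. auto_derive; [auto|].
        replace (Init.Nat.pred k) with (2 * m + 1)%nat by lia.
        rewrite Hk, pow_add, mult_INR, pow_1. simpl (INR 2). ring.
  - destruct IHp as [r [Hr Dr]], IHq as [s [Hs Ds]].
    exists (fun x => a * r x + s x). split; [now apply even_trig_lin|].
    intros x. replace (cos x * sin x * (a * r x + s x))
      with (a * (cos x * sin x * r x) + cos x * sin x * s x) by ring.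
    apply (is_derive_plus (fun x => a * p x) q); [|apply Ds].
    now apply is_derive_scal.
  - destruct IHp as [r [Hr Dr]]. exists r. split; [exact Hr|].
    intros x. now apply is_derive_ext with p.
Qed.

Lemma even_trig_continuous n q x : even_trig n q -> continuous q x.
Proof.
  intros Hq. destruct (even_trig_derive n q Hq) as [r [_ Hr]].
  apply (ex_derive_continuous q). now eexists.
Qed.

(** * The modes as trigonometric polynomials *)

Lemma e_even_trig (i : nat) :
  exists q, even_trig i q /\ forall x, e i x = cos x ^ 3 * q x.
Proof.
  exists (fun x => 2 * (sqrt (INR (fact i) * INR (fact (i + 2)))
    / Gamma (INR i + 3 / 2)) * jacobi i (1 / 2) (3 / 2) (cos (2 * x))). split.
  - apply even_trig_scal. unfold jacobi.
    assert (Hterm : forall s, (s <= i)%nat -> even_trig i (fun x =>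
      gbinom (INR i + 1 / 2) (i - s) * gbinom (INR i + 3 / 2) s *
      ((cos (2 * x) - 1) / 2) ^ s * ((cos (2 * x) + 1) / 2) ^ (i - s))).
    { intros s Hs.
      apply even_trig_ext with (fun x =>
        gbinom (INR i + 1 / 2) (i - s) * gbinom (INR i + 3 / 2) s *
        ((-1 * sin x ^ 2) ^ s * (cos x ^ 2) ^ (i - s))).
      - intros x.
        replace ((cos (2 * x) - 1) / 2) with (-1 * sin x ^ 2)
          by (rewrite cos_2a_sin; field).
        replace ((cos (2 * x) + 1) / 2) with (cos x ^ 2)
          by (rewrite cos_2a_cos; field). ring.
      - apply even_trig_scal.
        apply (even_trig_mono (s * 1 + (i - s) * 1)); [lia|].
        apply even_trig_mult; apply even_trig_power.
        + apply even_trig_scal, even_trig_sin2.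
        + apply even_trig_cos2. }
    exact (even_trig_sum i i _ Hterm).
  - intros x. unfold e. ring.
Qed.

Lemma e_derive (i : nat) (x : R) : is_derive (e i) x (omega i * de i x).
Proof.
  destruct (e_even_trig i) as [q [Hq He]].
  destruct (even_trig_derive i q Hq) as [r [_ Hr]].
  unfold de. replace (omega i * _) with (Derive (e i) x)
    by (field; pose proof (omega_ge_3 i); lra).
  apply Derive_correct.
  apply ex_derive_ext with (fun x => cos x ^ 3 * q x); [intros; now rewrite He|].
  auto_derive. eexists. apply Hr.
Qed.

Lemma de_even_trig (i : nat) :
  exists q, even_trig (S i) q /\ forall x, de i x = cos x ^ 2 * sin x * q x.
Proof.
  destruct (e_even_trig i) as [q [Hq He]].
  destruct (even_trig_derive i q Hq) as [r [Hr Dr]].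
  exists (fun x => / omega i * (-3 * q x + cos x ^ 2 * r x)). split.
  - apply even_trig_scal. apply even_trig_lin.
    + apply (even_trig_mono i); [lia|exact Hq].
    + apply (even_trig_mult 1 i); [apply even_trig_cos2|exact Hr].
  - intros x. unfold de.
    assert (D : is_derive (e i) x
      (-3 * cos x ^ 2 * sin x * q x + cos x ^ 3 * (cos x * sin x * r x))).
    { apply is_derive_ext with (fun x => cos x ^ 3 * q x); [intros; now rewrite He|].
      auto_derive; [eexists; apply Dr|].
      replace (Derive _ x) with (cos x * sin x * r x)
        by (symmetry; apply is_derive_unique, Dr). simpl. ring. }
    rewrite (is_derive_unique _ _ _ D). unfold Rdiv. ring.
Qed.

Definition lambda (i : nat) (x : R) : R :=
  omega i * sin x * cos (omega i * x) - cos x * sin (omega i * x).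

(** Obtained by differentiating [e_closed_form], since
    [kappa' = (omega^2 - 1) cos x cos (omega x)]. *)
Lemma de_closed_form (i : nat) (x : R) :
  de i x * sin x ^ 2 = amp i * cos x * lambda i x.
Proof.
  pose proof (e_closed_form i x) as H0. pose proof (omega_ge_3 i) as Hw.
  assert (D1 : is_derive (fun x => e i x * sin x) x
    (omega i * de i x * sin x + e i x * cos x)).
  { auto_derive; [eexists; apply e_derive|].
    replace (Derive _ x) with (omega i * de i x)
      by (symmetry; apply is_derive_unique, e_derive). ring. }
  assert (D2 : is_derive (fun x => e i x * sin x) x
    (amp i * ((omega i ^ 2 - 1) * cos x * cos (omega i * x)))).
  { apply is_derive_ext with (fun x => amp i * kappa i x).
    - intros t. symmetry. apply e_closed_form.
    - unfold kappa. auto_derive; [auto|]. ring. }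
  pose proof (is_derive_unique _ _ _ D1) as E.
  rewrite (is_derive_unique _ _ _ D2) in E.
  apply (Rmult_eq_reg_l (omega i)); [|lra].
  transitivity ((omega i * de i x * sin x + e i x * cos x) * sin x
    - (e i x * sin x) * cos x); [ring|].
  rewrite <- E, H0. unfold kappa, lambda. ring.
Qed.

(** * Orthogonality *)

Definition null_integral (f : R -> R) : Prop := is_RInt f 0 (PI / 2) 0.

Lemma null_integral_ext (f h : R -> R) :
  (forall x, f x = h x) -> null_integral f -> null_integral h.
Proof. intros H. apply is_RInt_ext. auto. Qed.

Lemma null_integral_lin (a b : R) (f h : R -> R) :
  null_integral f -> null_integral h ->
  null_integral (fun x => a * f x + b * h x).
Proof.
  intros Hf Hh. unfold null_integral.
  replace 0 with (plus (scal a 0) (scal b 0)) at 2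
    by (unfold plus, scal; simpl; unfold mult; simpl; ring).
  apply (is_RInt_plus (fun x => a * f x) (fun x => b * h x)).
  - exact (is_RInt_scal f _ _ a 0 Hf).
  - exact (is_RInt_scal h _ _ b 0 Hh).
Qed.

Lemma null_integral_derive (F f : R -> R) :
  (forall x, is_derive F x (f x)) -> (forall x, continuous f x) ->
  F 0 = F (PI / 2) -> null_integral f.
Proof.
  intros HF Hf Hb. unfold null_integral.
  replace 0 with (minus (F (PI / 2)) (F 0)) at 2
    by (unfold minus, plus, opp; simpl; rewrite Hb; ring).
  apply (is_RInt_derive F f); auto.
Qed.

Lemma cos_omega_PI2 (i : nat) : cos (omega i * (PI / 2)) = 0.
Proof.
  apply cos_eq_0_1. exists (Z.of_nat i + 1)%Z.
  rewrite plus_IZR, <- INR_IZR_INZ. unfold omega. field.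
Qed.

Ltac smooth := intros; match goal with |- continuous ?f ?x =>
  apply (ex_derive_continuous (f : R -> R) x); auto_derive; auto end.

Lemma sin_sqr (x : R) : sin x * sin x = 1 - cos x * cos x.
Proof. pose proof (sin2_cos2 x) as H. unfold Rsqr in H. lra. Qed.


(** For [J_p = int cos (w x) cos^p x], two integrations by parts give
    [(w^2 - p^2) J_p + p (p - 1) J_(p-2) = 0]. The boundary terms vanish because
    [w] is odd, and the factor [w^2 - p^2] is nonzero for [p < w]. *)
Lemma cos_orthogonal_cos_pow (i m : nat) : (m <= i)%nat ->
  null_integral (fun x => cos (omega i * x) * cos x ^ (2 * m + 1)).
Proof.
  set (w := omega i). intros Hm.
  (* the two integrations by parts at once; [p = q + 1] spares a predecessor *)
  assert (Hrec : forall p q : nat, p = (q + 1)%nat -> null_integral (fun x =>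
     (w ^ 2 - INR p) * (cos (w * x) * cos x ^ p)
      + INR p * INR q * (cos (w * x) * cos x ^ Nat.pred q * sin x ^ 2))).
  { intros p q Hpq.
    apply null_integral_derive with (fun x =>
      w * sin (w * x) * cos x ^ p - INR p * cos (w * x) * cos x ^ q * sin x).
    - intros x. auto_derive; [auto|].
      replace (Nat.pred p) with q by lia. rewrite Hpq, pow_add, pow_1. ring.
    - smooth.
    - rewrite cos_PI2, sin_0, Rmult_0_r, sin_0.
      replace (cos (w * (PI / 2))) with 0 by (symmetry; apply cos_omega_PI2).
      rewrite Hpq, !pow_add, !pow_1. ring. }
  assert (Hne : forall m, (m <= i)%nat -> w ^ 2 - INR (2 * m + 1) ^ 2 <> 0).
  { intros n Hn. unfold w, omega. rewrite plus_INR, mult_INR. simpl INR.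
    apply le_INR in Hn. pose proof (pos_INR n). nra. }
  induction m as [|m IH].
  - specialize (Hrec 1%nat 0%nat eq_refl).
    apply null_integral_ext with (2 := null_integral_lin (/ (w ^ 2 - 1)) 0 _ _ Hrec Hrec).
    specialize (Hne 0%nat Hm). simpl INR in *.
    intros x. simpl (2 * 0 + 1)%nat. field. simpl in *. lra.
  - specialize (IH ltac:(lia)). specialize (Hrec (2 * S m + 1)%nat (2 * S m)%nat eq_refl).
    specialize (Hne (S m) Hm).
    pose proof (null_integral_lin (/ (w ^ 2 - INR (2 * S m + 1) ^ 2))
      (- INR (2 * S m + 1) * INR (2 * S m) / (w ^ 2 - INR (2 * S m + 1) ^ 2))
      _ _ Hrec IH) as H.
    apply null_integral_ext with (2 := H). intros x.
    replace (Nat.pred (2 * S m)) with (2 * m + 1)%nat by lia.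
    replace (cos (w * x) * cos x ^ (2 * m + 1) * sin x ^ 2)
      with (cos (w * x) * cos x ^ (2 * m + 1) - cos (w * x) * cos x ^ (2 * S m + 1)).
    2:{ replace (2 * S m + 1)%nat with (S (S (2 * m + 1))) by lia.
        rewrite <- !tech_pow_Rmult. ring [(sin_sqr x)]. }
    rewrite plus_INR in *. simpl (INR 1) in *. field. exact Hne.
Qed.

(** One integration by parts reduces this to [cos_orthogonal_cos_pow]. *)
Lemma sin_orthogonal_sin_cos_pow (i m : nat) : (m <= i)%nat ->
  null_integral (fun x => sin (omega i * x) * sin x * cos x ^ (2 * m)).
Proof.
  intros Hm. set (w := omega i).
  assert (H : null_integral (fun x =>
    INR (2 * m + 1) * (sin (w * x) * sin x * cos x ^ (2 * m))
      - w * (cos (w * x) * cos x ^ (2 * m + 1)))).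
  { apply null_integral_derive with (fun x => - sin (w * x) * cos x ^ (2 * m + 1)).
    - intros x. set (p := (2 * m)%nat). remember (p + 1)%nat as q eqn:Hq.
      auto_derive; [auto|]. replace (Nat.pred q) with p by lia. ring.
    - smooth.
    - rewrite cos_PI2, Rmult_0_r, sin_0, !pow_add. ring. }
  pose proof (null_integral_lin (/ INR (2 * m + 1)) (w / INR (2 * m + 1)) _ _ H
    (cos_orthogonal_cos_pow i m Hm)) as H'.
  apply null_integral_ext with (2 := H'). intros x. fold w. field.
  apply not_0_INR. lia.
Qed.

(** Integrating the term [w sin (w x)] by parts leaves
    [cos (w x) ((2m + 4) cos^(2m+3) - (2m + 3) cos^(2m+1))]. *)
Lemma kappa_orthogonal_pow (i m : nat) : (m < i)%nat ->
  null_integral (fun x => kappa i x * sin x * cos x * cos x ^ (2 * m)).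
Proof.
  intros Hm. set (w := omega i).
  assert (H : null_integral (fun x => kappa i x * sin x * cos x * cos x ^ (2 * m)
     - (2 * INR m + 4) * (cos (w * x) * cos x ^ (2 * m + 3))
     + (2 * INR m + 3) * (cos (w * x) * cos x ^ (2 * m + 1)))).
  { apply null_integral_derive
      with (fun x => - cos (w * x) * sin x * cos x ^ (2 * m + 2)).
    - intros x. unfold kappa. fold w.
      assert (Hm2 : INR (2 * m + 2) = 2 * INR m + 2)
        by (rewrite plus_INR, mult_INR; reflexivity).
      remember (2 * m + 2)%nat as q eqn:Hq.
      auto_derive; [auto|]. replace (Nat.pred q) with (2 * m + 1)%nat by lia.
      rewrite Hm2, Hq, !pow_add.
      ring [(sin_sqr x)].
    - unfold kappa. smooth.
    - rewrite cos_PI2, sin_0, !pow_add. ring. }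
  pose proof (null_integral_lin 1 (2 * INR m + 4) _ _ H
    (cos_orthogonal_cos_pow i (S m) Hm)) as H1.
  pose proof (null_integral_lin 1 (- (2 * INR m + 3)) _ _ H1
    (cos_orthogonal_cos_pow i m ltac:(lia))) as H2.
  apply null_integral_ext with (2 := H2). intros x. fold w.
  replace (2 * S m + 1)%nat with (2 * m + 3)%nat by lia. ring.
Qed.

(** As for [kappa], now integrating the term [w cos (w x)] by parts. *)
Lemma lambda_orthogonal_pow (i m : nat) : (m < i)%nat ->
  null_integral (fun x => lambda i x * sin x * cos x * cos x ^ (2 * m)).
Proof.
  intros Hm. set (w := omega i).
  assert (H : null_integral (fun x => lambda i x * sin x * cos x * cos x ^ (2 * m)
     + (2 * INR m + 4) * (sin (w * x) * sin x * cos x ^ (2 * m + 2))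
     - (2 * INR m + 1) * (sin (w * x) * sin x * cos x ^ (2 * m)))).
  { apply null_integral_derive
      with (fun x => sin (w * x) * sin x ^ 2 * cos x ^ (2 * m + 1)).
    - intros x. unfold lambda. fold w.
      assert (Hm1 : INR (2 * m + 1) = 2 * INR m + 1)
        by (rewrite plus_INR, mult_INR; reflexivity).
      remember (2 * m + 1)%nat as q eqn:Hq.
      auto_derive; [auto|]. replace (Nat.pred q) with (2 * m)%nat by lia.
      rewrite Hm1, Hq, !pow_add. ring [(sin_sqr x)].
    - unfold lambda. smooth.
    - rewrite cos_PI2, sin_0, !pow_add. ring. }
  pose proof (null_integral_lin 1 (- (2 * INR m + 4)) _ _ H
    (sin_orthogonal_sin_cos_pow i (S m) Hm)) as H1.
  pose proof (null_integral_lin 1 (2 * INR m + 1) _ _ H1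
    (sin_orthogonal_sin_cos_pow i m ltac:(lia))) as H2.
  apply null_integral_ext with (2 := H2). intros x. fold w.
  replace (2 * S m)%nat with (2 * m + 2)%nat by lia. ring.
Qed.

Definition annihilates (W : R -> R) (n : nat) : Prop :=
  forall q, even_trig n q -> null_integral (fun x => W x * q x).

Lemma annihilates_pow (W : R -> R) (n : nat) :
  (forall m, (m <= n)%nat -> null_integral (fun x => W x * cos x ^ (2 * m))) ->
  annihilates W n.
Proof.
  intros H q Hq. induction Hq as [m Hm|a p q _ IHp _ IHq|p q Heq _ IHp].
  - now apply H.
  - apply null_integral_ext with (2 := null_integral_lin a 1 _ _ IHp IHq).
    intros x. ring.
  - apply null_integral_ext with (2 := IHp). intros x. now rewrite Heq.
Qed.

Lemma e_annihilates (i n : nat) : (n < i)%nat ->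
  annihilates (fun x => e i x * sin x ^ 2 * cos x) n.
Proof.
  intros Hn. apply annihilates_pow. intros m Hm.
  pose proof (kappa_orthogonal_pow i m ltac:(lia)) as H.
  apply null_integral_ext with (2 := null_integral_lin (amp i) 0 _ _ H H).
  intros x.
  replace (e i x * sin x ^ 2) with (e i x * sin x * sin x) by ring.
  rewrite e_closed_form. ring.
Qed.

Lemma de_annihilates (i n : nat) : (n < i)%nat ->
  annihilates (fun x => de i x * sin x ^ 3) n.
Proof.
  intros Hn. apply annihilates_pow. intros m Hm.
  pose proof (lambda_orthogonal_pow i m ltac:(lia)) as H.
  apply null_integral_ext with (2 := null_integral_lin (amp i) 0 _ _ H H).
  intros x.
  replace (de i x * sin x ^ 3) with (de i x * sin x ^ 2 * sin x) by ring.
  rewrite de_closed_form. ring.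
Qed.

(** In the variable [u = sin x] this integrates an even polynomial in [u]; on
    powers of the cosine it is the reduction formula
    [(sin cos^(2m))' = (2m + 1) cos^(2m+1) - 2m cos^(2m-1)]. *)
Lemma even_trig_antiderivative (n : nat) (q : R -> R) : even_trig n q ->
  exists r, even_trig n r /\ forall x, is_derive (fun x => sin x * r x) x (cos x * q x).
Proof.
  intros Hq. induction Hq as [m Hm|a p q _ IHp _ IHq|p q Heq _ IHp].
  - induction m as [|m IH].
    + exists (fun _ => 1). split; [apply even_trig_1|].
      intros x. auto_derive; [auto|]. simpl. ring.
    + destruct IH as [r [Hr Dr]]; [lia|].
      set (p := INR (2 * S m)).
      assert (Hp : 0 <= p) by apply pos_INR.
      exists (fun x => / (p + 1) * (cos x ^ (2 * S m) + p * r x)). split.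
      * apply even_trig_scal. apply even_trig_plus; [now apply even_trig_pow|].
        now apply even_trig_scal.
      * intros x.
        apply is_derive_ext with (fun x =>
          / (p + 1) * (sin x * cos x ^ (2 * S m) + p * (sin x * r x))).
        { intros t. simpl. ring. }
        assert (D : is_derive (fun x => sin x * cos x ^ (2 * S m)) x
          (cos x * cos x ^ (2 * S m) - p * (1 - cos x * cos x) * cos x ^ (2 * m + 1))).
        { subst p. remember (2 * S m)%nat as k eqn:Hk. auto_derive; [auto|].
          replace (Nat.pred k) with (2 * m + 1)%nat by lia. ring [(sin_sqr x)]. }
        replace (cos x * cos x ^ (2 * S m)) with (/ (p + 1) *
          ((cos x * cos x ^ (2 * S m) - p * (1 - cos x * cos x) * cos x ^ (2 * m + 1))
           + p * (cos x * cos x ^ (2 * m)))).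
        2:{ replace (2 * S m)%nat with (2 * m + 2)%nat by lia.
            rewrite !pow_add. field. lra. }
        apply (is_derive_scal (fun x => _ + _)).
        apply (is_derive_plus (fun x => sin x * cos x ^ (2 * S m))); [exact D|].
        apply is_derive_scal, Dr.
  - destruct IHp as [r [Hr Dr]], IHq as [s [Hs Ds]].
    exists (fun x => a * r x + s x). split; [now apply even_trig_lin|].
    intros x. apply is_derive_ext with (fun x => a * (sin x * r x) + sin x * s x).
    { intros t. simpl. ring. }
    replace (cos x * (a * p x + q x)) with (a * (cos x * p x) + cos x * q x) by ring.
    apply (is_derive_plus (fun x => a * (sin x * r x))); [|apply Ds].
    apply is_derive_scal, Dr.
  - destruct IHp as [r [Hr Dr]]. exists r. split; [exact Hr|].
    intros x. rewrite <- Heq. apply Dr.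
Qed.

Lemma e_continuous (i : nat) (x : R) : continuous (e i) x.
Proof. apply (ex_derive_continuous (e i)). eexists. apply e_derive. Qed.

Lemma g_integrand_continuous (i : nat) (x : R) :
  continuous (fun y => e i y * sin y * cos y) x.
Proof.
  apply (ex_derive_continuous (fun y => e i y * sin y * cos y)).
  auto_derive. eexists. apply e_derive.
Qed.

Lemma g_derive (i : nat) (x : R) : is_derive (g i) x (- (e i x * sin x * cos x)).
Proof.
  apply (is_derive_RInt' (V := R_NormedModule) (fun y => e i y * sin y * cos y)
    (g i) x (PI / 2)).
  - apply filter_forall. intros y.
    apply (RInt_correct (V := R_CompleteNormedModule)).
    apply (ex_RInt_continuous (V := R_CompleteNormedModule)).
    intros z _. apply g_integrand_continuous.
  - apply g_integrand_continuous.
Qed.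

Lemma g_continuous (i : nat) (x : R) : continuous (g i) x.
Proof. apply (ex_derive_continuous (g i)). eexists. apply g_derive. Qed.

(** Since [g_i' = - e_i sin cos], integration by parts moves the integration
    from [e_i] to the polynomial, and the claim becomes that for [e_i]. *)
Lemma g_annihilates (i n : nat) : (n < i)%nat ->
  annihilates (fun x => g i x * cos x) n.
Proof.
  intros Hn q Hq. destruct (even_trig_antiderivative n q Hq) as [r [Hr Dr]].
  assert (H : null_integral (fun x =>
    - (e i x * sin x * cos x) * (sin x * r x) + g i x * (cos x * q x))).
  { apply null_integral_derive with (fun x => g i x * (sin x * r x)).
    - intros x.
      exact (is_derive_mult (g i) (fun x => sin x * r x) x _ _
        (g_derive i x) (Dr x) Rmult_comm).
    - intros x.
      apply (continuous_plus (fun x => - (e i x * sin x * cos x) * (sin x * r x))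
        (fun x => g i x * (cos x * q x))).
      + apply (continuous_mult (fun x => - (e i x * sin x * cos x)) (fun x => sin x * r x)).
        * apply (continuous_opp (fun x => e i x * sin x * cos x)).
          apply g_integrand_continuous.
        * apply (ex_derive_continuous (fun x => sin x * r x)). eexists. apply Dr.
      + apply (continuous_mult (g i) (fun x => cos x * q x)); [apply g_continuous|].
        apply (continuous_mult cos q); [apply continuous_cos|].
        now apply even_trig_continuous with n.
    - replace (g i (PI / 2)) with 0
        by (symmetry; apply (RInt_point (V := R_CompleteNormedModule))).
      rewrite sin_0. ring. }
  pose proof (e_annihilates i n Hn r Hr) as H'.
  apply null_integral_ext with (2 := null_integral_lin 1 1 _ _ H H').
  intros x. ring.
Qed.

(** * Pointwise bounds *)

Lemma Rabs_sin_mult (n : nat) (x : R) :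
  Rabs (sin (INR n * x)) <= INR n * Rabs (sin x).
Proof.
  induction n as [|n IH].
  - simpl. rewrite Rmult_0_l, sin_0, Rabs_R0. lra.
  - rewrite S_INR, Rmult_plus_distr_r, Rmult_1_l, sin_plus.
    eapply Rle_trans; [apply Rabs_triang|]. rewrite !Rabs_mult.
    assert (Rabs (cos x) <= 1) by (apply Rabs_le, COS_bound).
    assert (Rabs (cos (INR n * x)) <= 1) by (apply Rabs_le, COS_bound).
    pose proof (Rabs_pos (sin x)). pose proof (Rabs_pos (sin (INR n * x))).
    nra.
Qed.

Lemma Rabs_cos_odd_mult (m : nat) (x : R) :
  Rabs (cos (INR (2 * m + 1) * x)) <= INR (2 * m + 1) * Rabs (cos x).
Proof.
  induction m as [|m IH].
  - simpl. rewrite !Rmult_1_l. lra.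
  - replace (INR (2 * S m + 1)) with (INR (2 * m + 1) + 2)
      by (rewrite !plus_INR, !mult_INR, (S_INR m); simpl INR; ring).
    rewrite Rmult_plus_distr_r, cos_plus, sin_2a.
    set (y := INR (2 * m + 1) * x) in *.
    eapply Rle_trans; [apply Rabs_triang|]. rewrite Rabs_Ropp, !Rabs_mult.
    rewrite (Rabs_pos_eq 2) by lra.
    assert (Rabs (cos (2 * x)) <= 1) by (apply Rabs_le, COS_bound).
    assert (Rabs (sin y) <= 1) by (apply Rabs_le, SIN_bound).
    assert (Rabs (sin x) <= 1) by (apply Rabs_le, SIN_bound).
    pose proof (Rabs_pos (cos x)). pose proof (Rabs_pos (cos y)).
    pose proof (Rabs_pos (sin x)). pose proof (Rabs_pos (sin y)).
    assert (Rabs (sin y) * (2 * Rabs (sin x) * Rabs (cos x)) <= 2 * Rabs (cos x)).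
    { assert (Rabs (sin y) * Rabs (sin x) <= 1) by nra. nra. }
    nra.
Qed.

Lemma omega_INR (i : nat) : omega i = INR (2 * (i + 1) + 1).
Proof. unfold omega. rewrite plus_INR, mult_INR, plus_INR. simpl. ring. Qed.

Lemma first_quadrant (x : R) : 0 < x < PI / 2 -> 0 < sin x <= 1 /\ 0 < cos x <= 1.
Proof.
  intros Hx. pose proof PI_RGT_0.
  pose proof (SIN_bound x). pose proof (COS_bound x).
  repeat split; try lra; [apply sin_gt_0|apply cos_gt_0]; lra.
Qed.

Lemma Rabs_omega_trig (i : nat) (x : R) : 0 < x < PI / 2 ->
  Rabs (sin (omega i * x)) <= Rmin 1 (omega i * sin x) /\
  Rabs (cos (omega i * x)) <= omega i * cos x.
Proof.
  intros Hx. destruct (first_quadrant x Hx) as [Hs Hc]. split.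
  - apply Rmin_glb; [apply Rabs_le, SIN_bound|].
    pose proof (Rabs_sin_mult (2 * (i + 1) + 1) x) as H.
    rewrite <- omega_INR, (Rabs_pos_eq (sin x)) in H; lra.
  - pose proof (Rabs_cos_odd_mult (i + 1) x) as H.
    rewrite <- omega_INR, (Rabs_pos_eq (cos x)) in H; lra.
Qed.

Lemma Rabs_lin_le (a b c d u v : R) :
  Rabs a <= u -> Rabs b <= v -> 0 <= c -> 0 <= d ->
  Rabs (c * a - d * b) <= c * u + d * v.
Proof.
  intros Ha Hb Hc Hd. eapply Rle_trans; [apply Rabs_triang|].
  rewrite Rabs_Ropp, !Rabs_mult, (Rabs_pos_eq c), (Rabs_pos_eq d) by assumption. nra.
Qed.

(** [kappa cos] is the derivative of [- cos^2 x cos (w x)] up to the bounded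
    term [- 3 sin x cos x cos (w x)]: integrating gains the factor [w] that
    [kappa] carries. The constant is [1 + 3 PI / 2 <= 7], from [PI <= 4]. *)
Lemma g_bound (i : nat) (x : R) : 0 < x < PI / 2 -> Rabs (g i x) <= 7 * Rabs (amp i).
Proof.
  intros Hx. set (w := omega i). pose proof PI_RGT_0. pose proof PI_4.
  set (b := fun y => sin y * cos y * cos (w * y)).
  assert (Hb : ex_RInt b x (PI / 2)).
  { apply (ex_RInt_continuous b). intros. unfold b. smooth. }
  assert (Hd : is_RInt (fun y => e i y * sin y * cos y + 3 * amp i * b y) x (PI / 2)
     (amp i * (cos x ^ 2 * cos (w * x)))).
  { replace (amp i * (cos x ^ 2 * cos (w * x))) with
      (minus (- amp i * (cos (PI / 2) ^ 2 * cos (w * (PI / 2))))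
        (- amp i * (cos x ^ 2 * cos (w * x))))
      by (unfold minus, plus, opp; simpl; rewrite cos_PI2; ring).
    apply (is_RInt_ext (fun y => amp i * (kappa i y * cos y + 3 * b y))).
    { intros y _. simpl. rewrite e_closed_form. unfold b. ring. }
    apply (is_RInt_derive (fun y => - amp i * (cos y ^ 2 * cos (w * y)))
      (fun y => amp i * (kappa i y * cos y + 3 * b y))).
    - intros y _. unfold kappa, b. fold w. auto_derive; [auto|]. ring.
    - unfold kappa, b. smooth. }
  assert (Hg : g i x = amp i * (cos x ^ 2 * cos (w * x)) - 3 * amp i * RInt b x (PI / 2)).
  { apply is_RInt_unique.
    apply (is_RInt_ext (fun y =>
      minus (e i y * sin y * cos y + 3 * amp i * b y) (scal (3 * amp i) (b y)))).
    { intros y _. unfold minus, plus, opp, scal; simpl. unfold mult; simpl. ring. }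
    apply (is_RInt_minus (fun y => e i y * sin y * cos y + 3 * amp i * b y)
      (fun y => scal (3 * amp i) (b y)) x (PI / 2) _ _ Hd).
    apply (is_RInt_scal b). now apply (RInt_correct (V := R_CompleteNormedModule)). }
  assert (Hcos : forall y, Rabs (cos y) <= 1) by (intros; apply Rabs_le, COS_bound).
  assert (Hsin : forall y, Rabs (sin y) <= 1) by (intros; apply Rabs_le, SIN_bound).
  assert (Hmul : forall a c, Rabs a <= 1 -> Rabs c <= 1 -> Rabs (a * c) <= 1).
  { intros a c Ha Hc. rewrite Rabs_mult.
    pose proof (Rabs_pos a). pose proof (Rabs_pos c). nra. }
  assert (HI : Rabs (RInt b x (PI / 2)) <= (PI / 2 - x) * 1).
  { apply abs_RInt_le_const; [lra|exact Hb|]. intros t _. unfold b. auto. }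
  assert (H1 : Rabs (cos x ^ 2 * cos (w * x)) <= 1).
  { replace (cos x ^ 2) with (cos x * cos x) by ring. auto. }
  rewrite Hg.
  replace (amp i * (cos x ^ 2 * cos (w * x)) - 3 * amp i * RInt b x (PI / 2))
    with ((1 * (cos x ^ 2 * cos (w * x)) - 3 * RInt b x (PI / 2)) * amp i) by ring.
  rewrite Rabs_mult. apply Rmult_le_compat_r; [apply Rabs_pos|].
  eapply Rle_trans; [apply (Rabs_lin_le _ _ _ _ _ _ H1 HI); lra|]. lra.
Qed.

Lemma e_bound_omega (i : nat) (x : R) : 0 < x < PI / 2 ->
  Rabs (e i x) <= 2 * omega i ^ 2 * Rabs (amp i) * cos x.
Proof.
  intros Hx. destruct (first_quadrant x Hx) as [Hs Hc].
  destruct (Rabs_omega_trig i x Hx) as [H1 H2]. pose proof (omega_ge_3 i) as Hw.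
  pose proof (Rle_trans _ _ _ H1 (Rmin_r _ _)) as H3.
  apply (Rmult_le_reg_r (sin x)); [lra|].
  rewrite <- (Rabs_pos_eq (sin x)) at 1 by lra.
  rewrite <- Rabs_mult, e_closed_form, Rabs_mult.
  assert (Hk : Rabs (kappa i x) <= 2 * omega i ^ 2 * cos x * sin x).
  { eapply Rle_trans; [apply (Rabs_lin_le _ _ _ _ _ _ H3 H2); nra|].
    assert (0 <= (omega i ^ 2 - omega i) * (cos x * sin x)) by
      (apply Rmult_le_pos; nra).
    lra. }
  pose proof (Rabs_pos (amp i)).
  apply (Rmult_le_compat_l _ _ _ H) in Hk. lra.
Qed.

Lemma e_bound_sin (i : nat) (x : R) : 0 < x < PI / 2 ->
  Rabs (e i x * sin x) <= 2 * omega i * Rabs (amp i) * cos x.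
Proof.
  intros Hx. destruct (first_quadrant x Hx) as [Hs Hc].
  destruct (Rabs_omega_trig i x Hx) as [H1 H2]. pose proof (omega_ge_3 i) as Hw.
  pose proof (Rle_trans _ _ _ H1 (Rmin_l _ _)) as H3.
  rewrite e_closed_form, Rabs_mult.
  assert (Hk : Rabs (kappa i x) <= 2 * omega i * cos x).
  { eapply Rle_trans; [apply (Rabs_lin_le _ _ _ _ _ _ H3 H2); nra|].
    assert (0 <= (1 - sin x) * (omega i * cos x)) by (apply Rmult_le_pos; nra).
    lra. }
  pose proof (Rabs_pos (amp i)).
  apply (Rmult_le_compat_l _ _ _ H) in Hk. lra.
Qed.

Lemma de_bound_sin (i : nat) (x : R) : 0 < x < PI / 2 ->
  Rabs (de i x * sin x) <= 2 * omega i * Rabs (amp i) * cos x.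
Proof.
  intros Hx. destruct (first_quadrant x Hx) as [Hs Hc].
  destruct (Rabs_omega_trig i x Hx) as [H1 _]. pose proof (omega_ge_3 i) as Hw.
  pose proof (Rle_trans _ _ _ H1 (Rmin_r _ _)) as H3.
  assert (H2 : Rabs (cos (omega i * x)) <= 1) by (apply Rabs_le, COS_bound).
  apply (Rmult_le_reg_r (sin x)); [lra|].
  rewrite <- (Rabs_pos_eq (sin x)) at 2 by lra.
  rewrite <- Rabs_mult.
  replace (de i x * sin x * sin x) with (de i x * sin x ^ 2) by ring.
  rewrite de_closed_form, !Rabs_mult, (Rabs_pos_eq (cos x)) by lra.
  assert (Hk : Rabs (lambda i x) <= 2 * omega i * sin x).
  { eapply Rle_trans; [apply (Rabs_lin_le _ _ _ _ _ _ H2 H3); nra|].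
    assert (0 <= (1 - cos x) * (omega i * sin x)) by (apply Rmult_le_pos; nra).
    lra. }
  pose proof (Rabs_pos (amp i)).
  assert (0 <= Rabs (amp i) * cos x) as Ha by (apply Rmult_le_pos; lra).
  apply (Rmult_le_compat_l _ _ _ Ha) in Hk. lra.
Qed.

(** The products below are cut into these four pieces, the quotients by
    [cos x] being what absorbs the singularities of [tan] and [1 / cos]. *)
Lemma factor_bounds : exists A, 0 < A /\ forall i x, 0 < x < PI / 2 ->
  Rabs (e i x / cos x) <= A * omega i /\
  Rabs (e i x * sin x / cos x) <= A /\
  Rabs (de i x * sin x / cos x) <= A /\
  Rabs (g i x) <= A / omega i.
Proof.
  destruct amp_bound as [A [HA H]]. exists (7 * A). split; [lra|].
  intros i x Hx. destruct (first_quadrant x Hx) as [Hs Hc].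
  specialize (H i). pose proof (omega_ge_3 i) as Hw.
  pose proof (Rabs_pos (amp i)) as H0.
  assert (H1 : Rabs (amp i) * omega i * omega i <= A * omega i)
    by (apply Rmult_le_compat_r; lra).
  assert (0 < A * omega i) by (apply Rmult_lt_0_compat; lra).
  assert (Hdiv : forall a b, Rabs a <= b * cos x -> Rabs (a / cos x) <= b).
  { intros a b Hab. unfold Rdiv.
    rewrite Rabs_mult, Rabs_inv, (Rabs_pos_eq (cos x)) by lra.
    now apply Rle_div_l. }
  repeat split.
  - apply Hdiv. eapply Rle_trans; [now apply e_bound_omega|].
    apply Rmult_le_compat_r; lra.
  - apply Hdiv. eapply Rle_trans; [now apply e_bound_sin|].
    apply Rmult_le_compat_r; lra.
  - apply Hdiv. eapply Rle_trans; [now apply de_bound_sin|].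
    apply Rmult_le_compat_r; lra.
  - eapply Rle_trans; [now apply g_bound|].
    assert (Hw0 : 0 < omega i) by lra. apply (proj1 (Rle_div_r _ _ _ Hw0)). lra.
Qed.

(** * The six integrals *)

(** The integrands contain [tan] or [1 / cos], with junk values at [PI / 2], so
    the factorization is required on the open interval only. *)
Definition factors_through (f W : R -> R) (n : nat) : Prop :=
  exists q, even_trig n q /\ forall x, 0 < x < PI / 2 -> f x = W x * q x.

Lemma RInt_factors_zero (f W : R -> R) (n : nat) :
  factors_through f W n -> annihilates W n -> RInt f 0 (PI / 2) = 0.
Proof.
  intros [q [Hq Hf]] HW. apply is_RInt_unique.
  apply (is_RInt_ext (fun x => W x * q x)); [|now apply HW].
  intros x. pose proof PI_RGT_0. rewrite Rmin_left, Rmax_right by lra.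
  intros Hx. now rewrite Hf.
Qed.

Lemma RInt_factors_bound (f W : R -> R) (n : nat) (M : R) :
  factors_through f W n -> (forall x, continuous W x) ->
  (forall x, 0 < x < PI / 2 -> Rabs (f x) <= M) ->
  Rabs (RInt f 0 (PI / 2)) <= 2 * M.
Proof.
  intros [q [Hq Hf]] HW HM. pose proof PI_RGT_0 as HPI. pose proof PI_4.
  assert (Hex : ex_RInt f 0 (PI / 2)).
  { apply (ex_RInt_ext (fun x => W x * q x)).
    - rewrite Rmin_left, Rmax_right by lra. intros x Hx. now rewrite Hf.
    - apply (ex_RInt_continuous (fun x => W x * q x)). intros x _.
      apply (continuous_mult W q); [apply HW|now apply even_trig_continuous with n]. }
  assert (HM0 : 0 <= M).
  { eapply Rle_trans; [apply Rabs_pos|apply (HM (PI / 4))]. lra. }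
  assert (Hconst : forall c, RInt (fun _ => c) 0 (PI / 2) = PI / 2 * c).
  { intros c. rewrite RInt_const. unfold scal; simpl; unfold mult; simpl. ring. }
  apply Rle_trans with (PI / 2 * M); [|nra].
  apply Rabs_le. split.
  - replace (- (PI / 2 * M)) with (PI / 2 * - M) by ring. rewrite <- Hconst.
    apply RInt_le; [lra|apply ex_RInt_const|exact Hex|].
    intros x Hx. specialize (HM x Hx). apply Rabs_le_between in HM. lra.
  - rewrite <- Hconst.
    apply RInt_le; [lra|exact Hex|apply ex_RInt_const|].
    intros x Hx. specialize (HM x Hx). apply Rabs_le_between in HM. lra.
Qed.

Lemma even_trig_triple (a b n1 n2 n3 n : nat) (q1 q2 q3 : R -> R) :
  even_trig n1 q1 -> even_trig n2 q2 -> even_trig n3 q3 ->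
  (a + b + n1 + n2 + n3 <= n)%nat ->
  even_trig n (fun x => (cos x ^ 2) ^ a * (sin x ^ 2) ^ b * q1 x * q2 x * q3 x).
Proof.
  intros H1 H2 H3 Hn.
  apply (even_trig_mono (a * 1 + b * 1 + n1 + n2 + n3)); [lia|].
  apply (even_trig_mult (a * 1 + b * 1 + n1 + n2) n3); [|exact H3].
  apply (even_trig_mult (a * 1 + b * 1 + n1) n2); [|exact H2].
  apply (even_trig_mult (a * 1 + b * 1) n1); [|exact H1].
  apply (even_trig_mult (a * 1) (b * 1)); apply even_trig_power.
  - apply even_trig_cos2.
  - apply even_trig_sin2.
Qed.

Ltac factor_out q1 H1 q2 H2 q3 H3 a b :=
  exists (fun x => (cos x ^ 2) ^ a * (sin x ^ 2) ^ b * q1 x * q2 x * q3 x);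
  split; [eapply even_trig_triple; eauto; lia|];
  let x := fresh "x" in let Hx := fresh "Hx" in
  intros x Hx; pose proof (proj2 (first_quadrant x Hx));
  rewrite H1, H2, H3; unfold tan; field; lra.

Lemma Rc_factors (i j k l : nat) : factors_through
  (fun x => e j x * de k x * de l x * de i x * (sin x ^ 3 / cos x))
  (fun x => de i x * sin x ^ 3) (j + k + l + 6).
Proof.
  destruct (e_even_trig j) as [q1 [Q1 H1]], (de_even_trig k) as [q2 [Q2 H2]],
    (de_even_trig l) as [q3 [Q3 H3]].
  factor_out q1 H1 q2 H2 q3 H3 3%nat 1%nat.
Qed.

Lemma Sc_factors (i j k l : nat) : factors_through
  (fun x => e j x * e k x * e l x * de i x * (sin x ^ 3 / cos x))
  (fun x => de i x * sin x ^ 3) (j + k + l + 6).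
Proof.
  destruct (e_even_trig j) as [q1 [Q1 H1]], (e_even_trig k) as [q2 [Q2 H2]],
    (e_even_trig l) as [q3 [Q3 H3]].
  factor_out q1 H1 q2 H2 q3 H3 4%nat 0%nat.
Qed.

Lemma Rbarc_factors (i j k l : nat) : factors_through
  (fun x => e j x * de k x * de l x * g i x * tan x ^ 2)
  (fun x => g i x * cos x) (j + k + l + 6).
Proof.
  destruct (e_even_trig j) as [q1 [Q1 H1]], (de_even_trig k) as [q2 [Q2 H2]],
    (de_even_trig l) as [q3 [Q3 H3]].
  factor_out q1 H1 q2 H2 q3 H3 2%nat 2%nat.
Qed.

Lemma Sbarc_factors (i j k l : nat) : factors_through
  (fun x => e j x * e k x * e l x * g i x * tan x ^ 2)
  (fun x => g i x * cos x) (j + k + l + 6).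
Proof.
  destruct (e_even_trig j) as [q1 [Q1 H1]], (e_even_trig k) as [q2 [Q2 H2]],
    (e_even_trig l) as [q3 [Q3 H3]].
  factor_out q1 H1 q2 H2 q3 H3 3%nat 1%nat.
Qed.

Lemma Hc_factors (i j k l : nat) : factors_through
  (fun x => e i x * e j x * e k x * e l x * tan x ^ 2)
  (fun x => e i x * sin x ^ 2 * cos x) (j + k + l + 6).
Proof.
  destruct (e_even_trig j) as [q1 [Q1 H1]], (e_even_trig k) as [q2 [Q2 H2]],
    (e_even_trig l) as [q3 [Q3 H3]].
  factor_out q1 H1 q2 H2 q3 H3 3%nat 0%nat.
Qed.

Lemma Hbarc_factors (i j k l : nat) : factors_through
  (fun x => e j x * e k x * de i x * de l x * tan x ^ 2)
  (fun x => de i x * sin x ^ 3) (j + k + l + 6).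
Proof.
  destruct (e_even_trig j) as [q1 [Q1 H1]], (e_even_trig k) as [q2 [Q2 H2]],
    (de_even_trig l) as [q3 [Q3 H3]].
  factor_out q1 H1 q2 H2 q3 H3 3%nat 0%nat.
Qed.

(** The margin [6] covers all six degrees; in [Rc] it is attained as
    [3 + 1] from the powers of [cos^2] and [sin^2] and [1] from each of [de k]
    and [de l]. *)
Lemma integrals_vanish (i j k l : nat) : (j + k + l + 6 < i)%nat ->
  Rc k l j i = 0 /\ Sc j k l i = 0 /\ Rbarc k l j i = 0 /\ Sbarc j k l i = 0 /\
  Hc k l j i = 0 /\ Hbarc i j k l = 0.
Proof.
  intros Hn. repeat split.
  - exact (RInt_factors_zero _ _ _ (Rc_factors i j k l) (de_annihilates i _ Hn)).
  - exact (RInt_factors_zero _ _ _ (Sc_factors i j k l) (de_annihilates i _ Hn)).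
  - exact (RInt_factors_zero _ _ _ (Rbarc_factors i j k l) (g_annihilates i _ Hn)).
  - exact (RInt_factors_zero _ _ _ (Sbarc_factors i j k l) (g_annihilates i _ Hn)).
  - exact (RInt_factors_zero _ _ _ (Hc_factors i j k l) (e_annihilates i _ Hn)).
  - exact (RInt_factors_zero _ _ _ (Hbarc_factors i j k l) (de_annihilates i _ Hn)).
Qed.

Lemma Rabs_mult_le (a b A B : R) :
  Rabs a <= A -> Rabs b <= B -> Rabs (a * b) <= A * B.
Proof.
  intros Ha Hb. rewrite Rabs_mult.
  apply Rmult_le_compat; auto using Rabs_pos.
Qed.

Lemma Rabs_prod_le (a b c d t A B C D : R) :
  Rabs a <= A -> Rabs b <= B -> Rabs c <= C -> Rabs d <= D -> Rabs t <= 1 ->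
  Rabs (a * b * c * d * t) <= A * B * C * D.
Proof.
  intros. rewrite <- (Rmult_1_r (A * B * C * D)).
  repeat apply Rabs_mult_le; assumption.
Qed.

(** One of the factors [e_j / cos] (two for [Hc] and [Hbarc]) is estimated by
    [A omega_j], the others by constants or, for [g_i], by [A / omega_i]. What
    is left over is a nonnegative power of [cos]. *)
Lemma integrals_bounded : exists C, forall i j k l,
  Rabs (Rc k l j i) <= C * omega j /\
  Rabs (Sc j k l i) <= C * omega j /\
  Rabs (Rbarc k l j i) <= C * (omega j / omega i) /\
  Rabs (Sbarc j k l i) <= C * (omega j / omega i) /\
  Rabs (Hc k l j i) <= C * (omega j * omega k) /\
  Rabs (Hbarc i j k l) <= C * (omega j * omega k).
Proof.
  destruct factor_bounds as [A [HA HB]]. exists (2 * A ^ 4). intros i j k l.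
  assert (Cde : forall x, continuous (fun x => de i x * sin x ^ 3) x).
  { destruct (de_even_trig i) as [q [Hq He]]. intros x.
    apply continuous_ext with (fun x => cos x ^ 2 * sin x ^ 4 * q x).
    - intros t. simpl. rewrite He. ring.
    - apply (continuous_mult (fun x => cos x ^ 2 * sin x ^ 4) q); [smooth|].
      now apply even_trig_continuous with (S i). }
  assert (Ce : forall x, continuous (fun x => e i x * sin x ^ 2 * cos x) x).
  { intros x. apply continuous_ext with (fun x => e i x * (sin x ^ 2 * cos x)).
    - intros t. simpl. ring.
    - apply (continuous_mult (e i) (fun x => sin x ^ 2 * cos x)); [|smooth].
      apply e_continuous. }
  assert (Cg : forall x, continuous (fun x => g i x * cos x) x).
  { intros x. apply (continuous_mult (g i) cos); [|apply continuous_cos].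
    apply g_continuous. }
  assert (Hcos : forall x m, 0 < x < PI / 2 -> Rabs (cos x ^ m) <= 1).
  { intros x m Hx. destruct (first_quadrant x Hx) as [_ Hc].
    rewrite <- RPow_abs. rewrite <- (pow1 m) at 1. apply pow_incr.
    rewrite Rabs_pos_eq; lra. }
  pose proof (omega_ge_3 i) as Wi.
  assert (Hq : forall f W n M B a b c d m, factors_through f W n ->
    (forall x, continuous W x) ->
    (forall x, 0 < cos x -> f x = a x * b x * c x * d x * cos x ^ m) ->
    (forall x, 0 < x < PI / 2 ->
      Rabs (a x * b x * c x * d x * cos x ^ m) <= M) ->
    M = A ^ 4 * B -> Rabs (RInt f 0 (PI / 2)) <= 2 * A ^ 4 * B).
  { intros f W n M B a b c d m Hf HW Hfac HM HAB.
    replace (2 * A ^ 4 * B) with (2 * M) by (rewrite HAB; ring).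
    apply (RInt_factors_bound f W n); auto.
    intros x Hx. rewrite Hfac; [now apply HM|apply (first_quadrant x Hx)]. }
  set (u := fun j x => e j x / cos x).
  set (v := fun j x => e j x * sin x / cos x).
  set (d := fun j x => de j x * sin x / cos x).
  assert (Hu : forall j x, 0 < x < PI / 2 -> Rabs (u j x) <= A * omega j)
    by (intros; apply HB; assumption).
  assert (Hv : forall j x, 0 < x < PI / 2 -> Rabs (v j x) <= A)
    by (intros j' x Hx; now apply (HB j')).
  assert (Hd : forall j x, 0 < x < PI / 2 -> Rabs (d j x) <= A)
    by (intros j' x Hx; now apply (HB j')).
  assert (Hg : forall x, 0 < x < PI / 2 -> Rabs (g i x) <= A / omega i)
    by (intros x Hx; now apply (HB i)).
  repeat split.
  - apply (Hq _ _ _ (A * omega j * A * A * A) (omega j) (u j) (d k) (d l) (d i) 3%nat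
      (Rc_factors i j k l) Cde); [| |ring].
    + intros x Hx. unfold u, d. field. lra.
    + intros x Hx. apply Rabs_prod_le; auto.
  - apply (Hq _ _ _ (A * omega j * A * A * A) (omega j) (u j) (v k) (v l) (d i) 3%nat
      (Sc_factors i j k l) Cde); [| |ring].
    + intros x Hx. unfold u, v, d. field. lra.
    + intros x Hx. apply Rabs_prod_le; auto.
  - apply (Hq _ _ _ (A * omega j * A * A * (A / omega i)) (omega j / omega i)
      (u j) (d k) (d l) (g i) 1%nat (Rbarc_factors i j k l) Cg); [| |field; lra].
    + intros x Hx. unfold u, d, tan. field. lra.
    + intros x Hx. apply Rabs_prod_le; auto.
  - apply (Hq _ _ _ (A * omega j * A * A * (A / omega i)) (omega j / omega i)
      (u j) (v k) (v l) (g i) 1%nat (Sbarc_factors i j k l) Cg); [| |field; lra].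
    + intros x Hx. unfold u, v, tan. field. lra.
    + intros x Hx. apply Rabs_prod_le; auto.
  - apply (Hq _ _ _ (A * omega j * (A * omega k) * A * A) (omega j * omega k)
      (u j) (u k) (v l) (v i) 2%nat (Hc_factors i j k l) Ce); [| |ring].
    + intros x Hx. unfold u, v, tan. field. lra.
    + intros x Hx. apply Rabs_prod_le; auto.
  - apply (Hq _ _ _ (A * omega j * (A * omega k) * A * A) (omega j * omega k)
      (u j) (u k) (d l) (d i) 2%nat (Hbarc_factors i j k l) Cde); [| |ring].
    + intros x Hx. unfold u, d, tan. field. lra.
    + intros x Hx. apply Rabs_prod_le; auto.
Qed.

(** * Asymptotics *)

(** [omega_i - omega_j - omega_k - omega_l = 2 (i - j - k - l) - 6]. *)
Lemma eventually_gap (i j k l : nat -> nat) (m : nat) :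
  is_lim_seq (fun n => comb (false, false, false) (i n) (j n) (k n) (l n)) p_infty ->
  eventually (fun n => (j n + k n + l n + m < i n)%nat).
Proof.
  intros H. apply is_lim_seq_spec in H.
  destruct (H (2 * INR m)) as [n0 Hn0]. exists n0. intros n Hn.
  specialize (Hn0 n Hn). unfold comb, omega, pm in Hn0.
  apply INR_lt. rewrite !plus_INR. lra.
Qed.

Lemma is_O_of_bound (u f : nat -> R) (C : R) :
  (forall n, Rabs (u n) <= C * Rabs (f n)) -> is_O u f.
Proof. intros H. exists C. exists 0%nat. auto. Qed.

Lemma is_sum_O_of_zero (u : nat -> R) (f : signs -> nat -> R) :
  eventually (fun n => u n = 0) -> is_sum_O u f.
Proof.
  intros H. exists 0. revert H. apply filter_imp. intros n ->.
  rewrite Rabs_R0. lra.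
Qed.

Lemma is_mul_sum_O_of_zero (u p : nat -> R) (f : signs -> nat -> R) :
  eventually (fun n => u n = 0) -> is_mul_sum_O u p f.
Proof.
  intros H. exists (fun _ => 0). split.
  - apply is_sum_O_of_zero. now exists 0%nat.
  - revert H. apply filter_imp. intros n ->. ring.
Qed.

Theorem proposition4p6 (N : nat) (i j k l : nat -> nat)
  (hi : filterlim i eventually eventually)
  (hj : filterlim j eventually eventually)
  (hk : filterlim k eventually eventually)
  (hl : filterlim l eventually eventually) :
  let w (n : nat) (s : signs) := comb s (i n) (j n) (k n) (l n) in
  ((exists s : signs, ~ is_lim_seq (fun n => w n s) p_infty) ->
    let f n := omega (j n) * / omega (i n) in
    let h n := omega (i n) * omega (j n) * omega (k n) in
    is_O (fun n => Rc (k n) (l n) (j n) (i n) / omega (i n)) f /\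
    is_O (fun n => Sc (j n) (k n) (l n) (i n) / omega (i n)) f /\
    is_O (fun n => Rbarc (k n) (l n) (j n) (i n)) f /\
    is_O (fun n => Sbarc (j n) (k n) (l n) (i n)) f /\
    is_O (fun n => omega (i n) * Hc (k n) (l n) (j n) (i n)) h /\
    is_O (fun n => omega (i n) * Hbarc (i n) (j n) (k n) (l n)) h)
  /\
  ((forall s : signs, is_lim_seq (fun n => w n s) p_infty) ->
    let p n := 1 / omega (i n) in
    let f s n := 1 / w n s ^ N in
    let h s n := omega (i n) / w n s ^ 3 in
    is_mul_sum_O (fun n => Rc (k n) (l n) (j n) (i n) / omega (i n)) p f /\
    is_mul_sum_O (fun n => Sc (j n) (k n) (l n) (i n) / omega (i n)) p f /\
    is_mul_sum_O (fun n => Rbarc (k n) (l n) (j n) (i n)) p f /\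
    is_mul_sum_O (fun n => Sbarc (j n) (k n) (l n) (i n)) p f /\
    is_sum_O (fun n => omega (i n) * Hc (k n) (l n) (j n) (i n)) h /\
    is_sum_O (fun n => omega (i n) * Hbarc (i n) (j n) (k n) (l n)) h).
Proof.
  intros w. split.
  - intros _ f h. destruct integrals_bounded as [C HC].
    assert (Hpos : forall n, 0 < omega n)
      by (intros n; pose proof (omega_ge_3 n); lra).
    assert (Hdiv : forall u a b, Rabs u <= C * omega a ->
      Rabs (u / omega b) <= C * Rabs (omega a * / omega b)).
    { intros u a b Hu. unfold Rdiv.
      rewrite !Rabs_mult, (Rabs_pos_eq (omega a)), <- Rmult_assoc
        by (apply Rlt_le, Hpos).
      apply Rmult_le_compat_r; [apply Rabs_pos|exact Hu]. }
    assert (Hquo : forall u a b, Rabs u <= C * (omega a / omega b) ->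
      Rabs u <= C * Rabs (omega a * / omega b)).
    { intros u a b Hu.
      rewrite (Rabs_pos_eq (omega a * / omega b)); [exact Hu|].
      apply Rlt_le, Rdiv_lt_0_compat; apply Hpos. }
    assert (Hmul : forall u a b c, Rabs u <= C * (omega b * omega c) ->
      Rabs (omega a * u) <= C * Rabs (omega a * omega b * omega c)).
    { intros u a b c Hu.
      rewrite !Rabs_mult, (Rabs_pos_eq (omega a)), (Rabs_pos_eq (omega b)),
        (Rabs_pos_eq (omega c)) by (apply Rlt_le, Hpos).
      pose proof (Hpos a).
      apply (Rmult_le_compat_l (omega a)) in Hu; lra. }
    subst f h. repeat split; apply is_O_of_bound with C; intros n;
      destruct (HC (i n) (j n) (k n) (l n)) as (H1 & H2 & H3 & H4 & H5 & H6); auto.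
  - intros Hw p f h.
    pose proof (eventually_gap i j k l 6 (Hw (false, false, false))) as Hgap.
    assert (Hzero : eventually (fun n =>
      Rc (k n) (l n) (j n) (i n) = 0 /\ Sc (j n) (k n) (l n) (i n) = 0 /\
      Rbarc (k n) (l n) (j n) (i n) = 0 /\ Sbarc (j n) (k n) (l n) (i n) = 0 /\
      Hc (k n) (l n) (j n) (i n) = 0 /\ Hbarc (i n) (j n) (k n) (l n) = 0)).
    { revert Hgap. apply filter_imp. intros n. apply integrals_vanish. }
    repeat split; (apply is_mul_sum_O_of_zero || apply is_sum_O_of_zero);
      revert Hzero; apply filter_imp;
      intros n (H1 & H2 & H3 & H4 & H5 & H6);
      rewrite ?H1, ?H2, ?H3, ?H4, ?H5, ?H6; unfold Rdiv; ring.
Qed.
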